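(* Let $P(\mathcal{C})=\{\boldsymbol{x}_0,\dots,\boldsymbol{x}_{p^m-1}\}\subset[0,1)^s$ be a digital net over $\mathbb{Z}_p$ ($p$ prime) with associated wavenumber set $\mathcal{K}(\mathcal{C})$. Let $\alpha>1$, $\gamma_1,\dots,\gamma_s>0$, and let $K(\boldsymbol{x},\boldsymbol{y})=\prod_{j=1}^s[1+\gamma_jK'(x_j,y_j)]$ with the univariate kernel $K'$ of parameter $\alpha$. Let $f$ be real-valued on $[0,1)^s$, and let $Sf(\boldsymbol{x})=\sum_{n=0}^{p^m-1}c_nK(\boldsymbol{x},\boldsymbol{x}_n)$ with real coefficients $c_n$ satisfy $Sf(\boldsymbol{x}_n)=f(\boldsymbol{x}_n)$ for $n=0,\dots,p^m-1$. Let $\emptyset\ne u\subseteq\{1,\dots,s\}$, $\gamma_u=\prod_{j\in u}\gamma_j$, and let $(Sf)_u$ be the ANOVA effect of $Sf$ for $u$, with variance $\sigma^2((Sf)_u)$. Then $$\sigma^2((Sf)_u)=\gamma_u^2\,p^{2m}\sum_{\boldsymbol{k}\in\mathcal{K}(\mathcal{C})}\bigl|\widetilde c(\boldsymbol{k})\bigr|^2\,\widetilde{R_u}(\boldsymbol{k}),$$ where $\widetilde c(\boldsymbol{k})=p^{-m}\sum_{n=0}^{p^m-1}c_n\overline{\mathrm{wal}_{\boldsymbol{k}}(\boldsymbol{x}_n)}$ and $\widetilde{R_u}(\boldsymbol{k})=p^{-m}\sum_{n=0}^{p^m-1}R_u(\boldsymbol{x}_{n,u},\boldsymbol{0})\,\mathrm{wal}_{\boldsymbol{k}}(\boldsymbol{x}_n)$.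 Moreover, $\sigma^2((Sf)_u)$ can be calculated from the values $f(\boldsymbol{x}_n)$, $K(\boldsymbol{x}_n,\boldsymbol{0})$ and $R_u(\boldsymbol{x}_{n,u},\boldsymbol{0})$, $n=0,\dots,p^m-1$, in $O(m\,p^m\log p)$ operations (with absolute implied constant).
   Context: $p$ is prime, $\mathbb{Z}_p=\{0,\dots,p-1\}$ is the field with $p$ elements, $\mathbb{N}_0$ the non-negative integers, $\mathbb{N}$ the positive integers, $\omega_p=e^{2\pi i/p}$. Digital net: $\mathcal{C}=(C_1,\dots,C_s)$ with $C_1,\dots,C_s$ $m\times m$ matrices over $\mathbb{Z}_p$. For $0\le n<p^m$ with $n=n_0+n_1p+\cdots+n_{m-1}p^{m-1}$ (base $p$ digits) let $\vec n=(n_0,\dots,n_{m-1})^T\in\mathbb{Z}_p^m$, $(y_{j,n,1},\dots,y_{j,n,m})^T=C_j\vec n\in\mathbb{Z}_p^m$, $x_{j,n}=y_{j,n,1}p^{-1}+\cdots+y_{j,n,m}p^{-m}$, and $\boldsymbol{x}_n=(x_{1,n},\dots,x_{s,n})$. $P(\mathcal{C})$ is the family $\boldsymbol{x}_0,\dots,\boldsymbol{x}_{p^m-1}$. Walsh functions: for $k=k_0+k_1p+\cdots+k_{a-1}p^{a-1}\in\mathbb{N}_0$ and $x\in[0,1)$ with base $p$ expansion $x=x_1/p+x_2/p^2+\cdots$ (infinitely many $x_i\ne p-1$), $\mathrm{wal}_k(x)=\omega_p^{x_1k_0+\cdots+x_ak_{a-1}}$; for $\boldsymbol{k}\in\mathbb{N}_0^s$,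 $\boldsymbol{x}\in[0,1)^s$, $\mathrm{wal}_{\boldsymbol{k}}(\boldsymbol{x})=\prod_{j=1}^s\mathrm{wal}_{k_j}(x_j)$. Cosets: for $\boldsymbol{k}\in\mathbb{N}_0^s$ with $k_j=k_{j,0}+k_{j,1}p+\cdots$ let $\vec k_j^{(m)}=(k_{j,0},\dots,k_{j,m-1})^T\in\mathbb{Z}_p^m$ and $\mathcal{C}\cdot\boldsymbol{k}=C_1^T\vec k_1^{(m)}+\cdots+C_s^T\vec k_s^{(m)}\in\mathbb{Z}_p^m$. For $\vec h\in\mathbb{Z}_p^m$ let $\mathcal{D}(\vec h)=\{\boldsymbol{k}\in\mathbb{N}_0^s:\mathcal{C}\cdot\boldsymbol{k}=\vec h\}$. Standing assumption: all $p^m$ sets $\mathcal{D}(\vec h)$ are non-empty. The set $\mathcal{K}(\mathcal{C})$: let $\nu(0)=0$, $\nu(k)=1+\max\{i:k_i\ne0\}$ for $k=k_0+k_1p+\cdots>0$, and $\nu(\boldsymbol{k})=\sum_{j=1}^s\nu(k_j)$. $\mathcal{K}(\mathcal{C})$ contains exactly one element of each $\mathcal{D}(\vec h)$, $\vec h\in\mathbb{Z}_p^m$: the element minimizing $\nu$ over $\mathcal{D}(\vec h)$, ties broken by taking the lexicographically smallest. Thus $|\mathcal{K}(\mathcal{C})|=p^m$. Univariate kernels: for $k=k_0+k_1p+\cdots+k_ap^a\in\mathbb{N}$ with $k_a\ne0$ put $\widehat{K'}(k)=\frac{p^\alpha-p}{p^\alpha(p-1)}\,p^{-\alpha a}$,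 and for $x,y\in[0,1)$ let $K'(x,y)=\sum_{k=1}^\infty\widehat{K'}(k)\,\mathrm{wal}_k(x)\overline{\mathrm{wal}_k(y)}$ and $R'(x,y)=\sum_{k=1}^\infty\bigl[\widehat{K'}(k)\bigr]^2\,\mathrm{wal}_k(x)\overline{\mathrm{wal}_k(y)}$. For $u\subseteq\{1,\dots,s\}$ and $\boldsymbol{x}_u=(x_j)_{j\in u}$, $R_u(\boldsymbol{x}_u,\boldsymbol{y}_u)=\prod_{j\in u}R'(x_j,y_j)$; $\boldsymbol{x}_{n,u}$ denotes $(x_{j,n})_{j\in u}$. ANOVA effects of $g:[0,1)^s\to\mathbb{R}$: $g_\emptyset=\int_{[0,1]^s}g(\boldsymbol{x})\,d\boldsymbol{x}$ and, recursively, $g_u(\boldsymbol{x}_u)=\int_{[0,1]^{\bar u}}g(\boldsymbol{x})\,d\boldsymbol{x}_{\bar u}-\sum_{v\subsetneq u}g_v(\boldsymbol{x}_v)$, where $\bar u=\{1,\dots,s\}\setminus u$. The variance is $\sigma^2(g_u)=\int_{[0,1]^u}\bigl[g_u(\boldsymbol{x}_u)-\int_{[0,1]^u}g_u(\boldsymbol{x}'_u)\,d\boldsymbol{x}'_u\bigr]^2d\boldsymbol{x}_u$. ''Operations'' means arithmetic operations on complex numbers, with fixed complex constants (such as powers of roots of unity) available; the correspondence $\boldsymbol{k}\leftrightarrow\vec h=\mathcal{C}\cdot\boldsymbol{k}$ is regarded as known. *)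

(* Defs.v *)
From HB Require Import structures.
From mathcomp Require Import all_boot all_order all_algebra.
From mathcomp Require Import all_classical all_reals all_analysis.
From mathcomp Require Import complex.

Set Implicit Arguments.
Unset Strict Implicit.
Unset Printing Implicit Defensive.

Import Order.TTheory GRing.Theory Num.Theory.
Import numFieldNormedType.Exports.

Local Open Scope classical_set_scope.
Local Open Scope ring_scope.

(** ** Digits and digital nets *)

Definition digit (p k i : nat) : nat := ((k %/ p ^ i) %% p)%N.

(* (k_0, ..., k_{m-1})^T; this serves both for the vector of n < p^m and for
   the truncation to m digits of a component of a wavenumber *)
Definition dvec (p m k : nat) : 'cV['F_p]_m := \col_(i < m) (digit p k i)%:R.

Definition netpt (R : realType) (p m s : nat) (C : 'I_s -> 'M['F_p]_m)
    (n : 'I_(p ^ m)) : 'I_s -> R :=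
  fun j => \sum_(i < m) ((C j *m dvec p m n) i 0 : nat)%:R / p%:R ^+ i.+1.

(* The digit x_{i+1}.  Taking floors selects the base p expansion of x in
   which infinitely many digits differ from p - 1. *)
Definition xdigit (R : realType) (p : nat) (x : R) (i : nat) : nat :=
  `|(Num.floor (x * p%:R ^+ i.+1) %% p%:Z)%Z|%N.

(* nu(k) is the number of base p digits of k; a nonzero digit k_i has i < k *)
Definition nu1 (p k : nat) : nat := \max_(i < k | digit p k i != 0%N) i.+1.

Definition nu (p s : nat) (k : {ffun 'I_s -> nat}) : nat :=
  (\sum_(j < s) nu1 p (k j))%N.

(** ** Walsh functions *)

Definition omega (R : realType) (p : nat) : R[i] :=
  Complex (cos (2 * pi / p%:R)) (sin (2 * pi / p%:R)).

Definition wal1 (R : realType) (p k : nat) (x : R) : R[i] :=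
  omega R p ^+ (\sum_(i < nu1 p k) xdigit p x i * digit p k i)%N.

Definition wal (R : realType) (p s : nat) (k : {ffun 'I_s -> nat})
    (x : 'I_s -> R) : R[i] :=
  \prod_(j < s) wal1 p (k j) (x j).

(** ** The cosets D(h) and the set K(C) *)

Definition cdot (p m s : nat) (C : 'I_s -> 'M['F_p]_m)
    (k : {ffun 'I_s -> nat}) : 'cV['F_p]_m :=
  \sum_(j < s) (C j)^T *m dvec p m (k j).

Definition Dset (p m s : nat) (C : 'I_s -> 'M['F_p]_m) (h : 'cV['F_p]_m) :
    set {ffun 'I_s -> nat} :=
  [set k | cdot C k = h].

Definition lexle (s : nat) (k l : {ffun 'I_s -> nat}) : Prop :=
  k = l \/
  exists2 j : 'I_s, (forall i : 'I_s, (i < j)%N -> k i = l i) & (k j < l j)%N.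

(* k is the least element, for nu and then the lexicographic order, of the
   unique coset it belongs to *)
Definition Kset (p m s : nat) (C : 'I_s -> 'M['F_p]_m) :
    set {ffun 'I_s -> nat} :=
  [set k | forall l, Dset C (cdot C k) l ->
     (nu p k < nu p l)%N \/ (nu p k = nu p l /\ lexle k l)].

(** ** Kernels *)

(* for k > 0 the leading digit of k has index (nu1 p k).-1 *)
Definition Khat (R : realType) (p : nat) (alpha : R) (k : nat) : R :=
  (p%:R `^ alpha - p%:R) / (p%:R `^ alpha * (p%:R - 1))
  * p%:R `^ (- (alpha * (nu1 p k).-1%:R)).

(* sum_{k >= 1} w k * wal_k(x) * conj (wal_k(y)), a limit for the topology that
   the complex modulus induces on R[i] *)
Definition walsh_series (R : realType) (p : nat) (w : nat -> R) (x y : R) :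
    R[i]^o :=
  limn (fun N => \sum_(1 <= k < N)
    ((w k)%:C%C * wal1 p k x * Num.conj (wal1 p k y)) : R[i]^o).

Definition K1 (R : realType) (p : nat) (alpha x y : R) : R[i] :=
  walsh_series p (Khat p alpha) x y.

Definition R1 (R : realType) (p : nat) (alpha x y : R) : R[i] :=
  walsh_series p (fun k => Khat p alpha k ^+ 2) x y.

Definition Kker (R : realType) (p s : nat) (alpha : R) (gamma : 'I_s -> R)
    (x y : 'I_s -> R) : R[i] :=
  \prod_(j < s) (1 + (gamma j)%:C%C * K1 p alpha (x j) (y j)).

Definition Rker (R : realType) (p s : nat) (alpha : R) (u : {set 'I_s})
    (x y : 'I_s -> R) : R[i] :=
  \prod_(j in u) R1 p alpha (x j) (y j).

(** ** The spline and the discrete Walsh coefficients *)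

Definition spline (R : realType) (p m s : nat) (C : 'I_s -> 'M['F_p]_m)
    (alpha : R) (gamma : 'I_s -> R) (c : 'I_(p ^ m) -> R) (x : 'I_s -> R) :
    R[i] :=
  \sum_(n < p ^ m) (c n)%:C%C * Kker p alpha gamma x (netpt R C n).

(* The spline is real-valued (k and its digitwise negative contribute conjugate
   terms to K1); the real part only changes the codomain. *)
Definition rspline (R : realType) (p m s : nat) (C : 'I_s -> 'M['F_p]_m)
    (alpha : R) (gamma : 'I_s -> R) (c : 'I_(p ^ m) -> R) (x : 'I_s -> R) : R :=
  complex.Re (spline C alpha gamma c x).

Definition ctilde (R : realType) (p m s : nat) (C : 'I_s -> 'M['F_p]_m)
    (c : 'I_(p ^ m) -> R) (k : {ffun 'I_s -> nat}) : R[i] :=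
  (p%:R ^+ m)^-1 *
  \sum_(n < p ^ m) (c n)%:C%C * Num.conj (wal p k (netpt R C n)).

Definition Rtilde (R : realType) (p m s : nat) (C : 'I_s -> 'M['F_p]_m)
    (alpha : R) (u : {set 'I_s}) (k : {ffun 'I_s -> nat}) : R[i] :=
  (p%:R ^+ m)^-1 *
  \sum_(n < p ^ m)
    Rker p alpha u (netpt R C n) (fun=> 0) * wal p k (netpt R C n).

(** ** Integration over [0,1]^w and ANOVA effects *)

Definition tcons (R : realType) (n : nat)
    (z : n.-tuple (measurableTypeR R) * measurableTypeR R) :
    n.+1.-tuple (measurableTypeR R) :=
  [tuple of z.2 :: z.1].

Lemma measurable_tcons (R : realType) (n : nat) :
  measurable_fun [set: n.-tuple (measurableTypeR R) * measurableTypeR R]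
    (@tcons R n).
Proof. exact: measurable_cons. Qed.

Definition measure_tcons (R : realType) (n : nat)
    (mu : {measure set (n.-tuple (measurableTypeR R)) -> \bar R}) :
    set (n.+1.-tuple (measurableTypeR R)) -> \bar R :=
  pushforward (mu \x lebesgue_measure)%E (@tcons R n).

Lemma measure_tcons0 (R : realType) (n : nat)
    (mu : {measure set (n.-tuple (measurableTypeR R)) -> \bar R}) :
  measure_tcons mu set0 = 0%E.
Proof. by apply: measure0; exact: measurable_tcons. Qed.

Lemma measure_tcons_ge0 (R : realType) (n : nat)
    (mu : {measure set (n.-tuple (measurableTypeR R)) -> \bar R})
    (A : set (n.+1.-tuple (measurableTypeR R))) :
  (0 <= measure_tcons mu A)%E.
Proof. by apply: measure_ge0; exact: measurable_tcons. Qed.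

Lemma measure_tcons_sigma_additive (R : realType) (n : nat)
    (mu : {measure set (n.-tuple (measurableTypeR R)) -> \bar R}) :
  semi_sigma_additive (measure_tcons mu).
Proof. by apply: measure_semi_sigma_additive; exact: measurable_tcons. Qed.

HB.instance Definition _ (R : realType) (n : nat)
    (mu : {measure set (n.-tuple (measurableTypeR R)) -> \bar R}) :=
  isMeasure.Build _ _ _ (measure_tcons mu) (measure_tcons0 mu)
    (@measure_tcons_ge0 R n mu) (@measure_tcons_sigma_additive R n mu).

(* n-dimensional Lebesgue measure *)
Fixpoint lebesgue_tuple (R : realType) (n : nat) :
    {measure set (n.-tuple (measurableTypeR R)) -> \bar R} :=
  match n with
  | 0 => dirac [tuple]
  | n'.+1 => measure_tcons (lebesgue_tuple R n')
  end.

Definition unit_cube (R : realType) (n : nat) :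
    set (n.-tuple (measurableTypeR R)) :=
  [set z | forall i, 0 <= tnth z i <= 1].

(* x with its coordinates of index in w replaced by the entries of z *)
Definition subst_on (R : realType) (s : nat) (w : {set 'I_s}) (x : 'I_s -> R)
    (z : seq R) : 'I_s -> R :=
  fun j => if j \in w then z`_(index j (enum w)) else x j.

(* The integral of h over the variables x_w in [0,1]^w, as a function of x
   that depends only on the variables outside w. *)
Definition int_over (R : realType) (s : nat) (w : {set 'I_s})
    (h : ('I_s -> R) -> R) (x : 'I_s -> R) : R :=
  \int[lebesgue_tuple R #|w|]_(z in unit_cube (R := R) (n := #|w|))
     h (subst_on w x z).

(* Effects are functions of x in R^s that depend only on x_u; n >= #|u| bounds
   the depth of the recursion over proper subsets, see anovaE. *)
Fixpoint anova_rec (R : realType) (s : nat) (n : nat) (g : ('I_s -> R) -> R)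
    (u : {set 'I_s}) (x : 'I_s -> R) : R :=
  int_over (~: u) g x -
  \sum_(v : {set 'I_s} | v \proper u)
    (if n is n'.+1 then anova_rec n' g v x else 0).

Definition anova (R : realType) (s : nat) (g : ('I_s -> R) -> R)
    (u : {set 'I_s}) : ('I_s -> R) -> R :=
  anova_rec #|u| g u.

Lemma anova_recE (R : realType) (s : nat) (g : ('I_s -> R) -> R) (n : nat)
    (u : {set 'I_s}) (x : 'I_s -> R) :
  (#|u| <= n)%N ->
  anova_rec n g u x =
  int_over (~: u) g x - \sum_(v : {set 'I_s} | v \proper u) anova g v x.
Proof.
have [N] := ubnP n; elim: N n u => // N IH n u nN un.
have -> : anova_rec n g u x = int_over (~: u) g x -
  \sum_(v : {set 'I_s} | v \proper u)
    (if n is n'.+1 then anova_rec n' g v x else 0) by case: n {nN un}.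
congr (_ - _); apply: eq_bigr => v /proper_card vu.
have vn := leq_trans vu un.
case: n => [|n] in nN un vn *; first by rewrite ltn0 in vn.
by rewrite /anova !IH//; exact: leq_ltn_trans vn nN.
Qed.

Lemma anovaE (R : realType) (s : nat) (g : ('I_s -> R) -> R)
    (u : {set 'I_s}) (x : 'I_s -> R) :
  anova g u x =
  int_over (~: u) g x - \sum_(v : {set 'I_s} | v \proper u) anova g v x.
Proof. exact: anova_recE. Qed.

(* int_over u integrates out every variable on which the integrand depends, so
   its value at the point 0 is the constant that it takes everywhere *)
Definition effect_variance (R : realType) (s : nat) (g : ('I_s -> R) -> R)
    (u : {set 'I_s}) : R :=
  int_over u
    (fun x => (anova g u x - int_over u (anova g u) (fun=> 0)) ^+ 2) (fun=> 0).

(** ** Straight-line arithmetic programs *)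

(* An operand is a fixed constant, an input value, or the result of the
   instruction number r of the program (counted from 0). *)
Inductive operand (F : fieldType) (I : Type) : Type :=
  | Cst of F
  | Inp of I
  | Res of nat.

Inductive arith : Type := Add | Sub | Mul | Div.

Record instr (F : fieldType) (I : Type) : Type :=
  Instr { iop : arith; ilhs : operand F I; irhs : operand F I }.

(* The number of operations of a program is the number of its instructions. *)
Record program (F : fieldType) (I : Type) : Type :=
  Program { instrs : seq (instr F I); output : operand F I }.

Definition apply_arith (F : fieldType) (o : arith) (a b : F) : option F :=
  match o with
  | Add => Some (a + b)
  | Sub => Some (a - b)
  | Mul => Some (a * b)
  | Div => if b == 0 then None else Some (a / b)
  end.

Definition fetch (F : fieldType) (I : Type) (inp : I -> F) (mem : seq F)
    (o : operand F I) : option F :=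
  match o with
  | Cst a => Some a
  | Inp i => Some (inp i)
  | Res r => onth mem r
  end.

Definition step (F : fieldType) (I : Type) (inp : I -> F) (mem : seq F)
    (i : instr F I) : option (seq F) :=
  match fetch inp mem (ilhs i), fetch inp mem (irhs i) with
  | Some a, Some b => omap (rcons mem) (apply_arith (iop i) a b)
  | _, _ => None
  end.

(* None if a division by zero occurs or a result is used before it exists *)
Definition run (F : fieldType) (I : Type) (inp : I -> F) (P : program F I) :
    option F :=
  obind (fun mem => fetch inp mem (output P))
    (foldl (fun mem i => obind (fun mem' => step inp mem' i) mem)
       (Some [::]) (instrs P)).

Inductive datum (N : nat) : Type :=
  | Fval of 'I_N
  | Kval of 'I_N
  | Rval of 'I_N.

Definition net_data (R : realType) (p m s : nat) (C : 'I_s -> 'M['F_p]_m)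
    (alpha : R) (gamma : 'I_s -> R) (u : {set 'I_s}) (f : ('I_s -> R) -> R)
    (d : datum (p ^ m)) : R[i] :=
  match d with
  | Fval n => (f (netpt R C n))%:C%C
  | Kval n => Kker p alpha gamma (netpt R C n) (fun=> 0)
  | Rval n => Rker p alpha u (netpt R C n) (fun=> 0)
  end.

(* Main.v *)
Require Import Defs.
From HB Require Import structures.
From mathcomp Require Import all_boot all_order all_algebra.
From mathcomp Require Import all_classical all_reals all_analysis.
From mathcomp Require Import complex.
From mathcomp Require Import zify ring lra measurable_realfun.

Set Implicit Arguments.
Unset Strict Implicit.
Unset Printing Implicit Defensive.

Import Order.TTheory GRing.Theory Num.Theory.
Import numFieldNormedType.Exports.

Local Open Scope classical_set_scope.
Local Open Scope ring_scope.

(** The variance formula is Fourier analysis on the group of column vectors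
    'cV['F_p]_m, which indexes the points of the net. A Walsh function at a net
    point is a character of the index vector ([wal_netpt]), so that both
    product kernels, restricted to the net, are functions of the difference of
    two indices ([Kker_netpt], [Rker_netpt]).

    The coefficient of wal_k in a univariate kernel depends only on the number
    of digits of k. The kernel is therefore a series of differences of
    Walsh-Dirichlet kernels, and these are explicit: D_a(x, y) is p^a if x and
    y share their first a digits, and 0 otherwise ([dirichletE]). In
    particular the kernels are real. As D_a(., y) integrates to 1 and
    D_a(., y) D_b(., z) integrates to D_min(a, b)(y, z), the kernel K' has mean
    0 and the integral of K'(x, y) K'(x, z) over x is R'(y, z)
    ([int01_kernel1], [int01_kernel1M]). Expanding the product of the factors
    1 + gamma_j K' over subsets of the variables then is the ANOVA
    decomposition ([anova_product]), and the variance of the effect for u is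
    gamma_u^2 times the sum of c_n c_n' R_u(x_n, x_n') over all pairs
    ([variance_product]). Plancherel's formula turns this quadratic form into
    a sum over frequencies ([spline_variance]); a frequency is a coset D(h),
    and K(C) contains one element of each ([Kset_bij]).

    For the operation count, the interpolation conditions say that f is the
    convolution of c and K on the group, so that the transform of c is the
    quotient of those of f and K. The divisor never vanishes because all
    Fourier coefficients of K are positive ([trans_netK_neq0]). The
    coefficients c_n are real, hence the squared modulus of the transform at h
    is its value at h times its value at - h. What remains are three Fourier
    transforms over (Z_p)^m, which decompose into transforms of length p, one
    digit at a time ([computes_mdft]). To keep the constant independent of p, a
    transform of length p is rewritten as a convolution with a chirp and
    carried out by radix-2 transforms of length between 2 p and 4 p
    ([computes_dft], [computes_fft]). *)

(** * Straight-line programs *)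

Section Circuits.
Variables (F : fieldType) (I X : Type) (inp : X -> I -> F).
Implicit Types (cs : seq (instr F I)) (V W : set (X -> F)).

Definition exec cs (x : X) : option (seq F) :=
  foldl (fun mem i => obind (fun mem' => step (inp x) mem' i) mem)
    (Some [::]) cs.

(** The operand may depend on the value but not on the input [x]: one program
    serves all inputs. *)
Definition avail cs V : Prop :=
  exists2 mem : X -> seq F, forall x, exec cs x = Some (mem x) &
    forall v, V v ->
      exists o, forall x, fetch (inp x) (mem x) o = Some (v x).

(** Starting from an arbitrary program that makes [V] available lets costs add
    up under composition. *)
Record computes (n : nat) V W : Prop := Computes {
  computesP : forall cs, avail cs V ->
    exists2 cs', (size cs' <= n)%N & avail (cs ++ cs') (V `|` W) }.

Lemma exec_rcons cs i x :
  exec (rcons cs i) x = obind (fun mem => step (inp x) mem i) (exec cs x).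
Proof. by rewrite /exec -cats1 foldl_cat. Qed.

Lemma stepE x mem i mem' : step (inp x) mem i = Some mem' ->
  exists v, mem' = rcons mem v.
Proof.
rewrite /step; case: fetch => // a; case: fetch => // b.
by case: apply_arith => //= v [<-]; exists v.
Qed.

Lemma size_exec cs x mem : exec cs x = Some mem -> size mem = size cs.
Proof.
elim/last_ind: cs mem => [|cs i IH] mem; first by move=> [<-].
rewrite exec_rcons size_rcons; case E : exec => [mem1|] //= /stepE [v ->].
by rewrite size_rcons (IH _ E).
Qed.

Lemma exec_cat cs cs' x mem' : exec (cs ++ cs') x = Some mem' ->
  exists2 mem, exec cs x = Some mem & exists t, mem' = mem ++ t.
Proof.
elim/last_ind: cs' mem' => [|cs' i IH] mem'.
  by rewrite cats0 => ->; exists mem' => //; exists [::]; rewrite cats0.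
rewrite -rcons_cat exec_rcons.
case E : (exec _ x) => [mem1|] //= /stepE [v ->].
have [mem -> [t tE]] := IH _ E; exists mem => //.
by exists (rcons t v); rewrite tE rcons_cat.
Qed.

Lemma avail_nil : avail [::] set0.
Proof. by exists (fun=> [::]). Qed.

(** The memory only grows, so that what was available remains available. *)
Lemma avail_cat cs cs' V W :
  avail cs V -> avail (cs ++ cs') W -> avail (cs ++ cs') (V `|` W).
Proof.
move=> [mem memE memV] [mem' memE' memW]; exists mem' => // v [/memV|/memW //].
move=> [op oE]; exists op => x.
have [mem1] := exec_cat (memE' x); rewrite memE => -[<-] [t ->].
by have := oE x; case: op {oE} => //= r; rewrite onth_cat onthE;
  case: ltnP => // ?; rewrite nth_default // size_map.
Qed.

Lemma avail_sub cs V W : W `<=` V -> avail cs V -> avail cs W.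
Proof. by move=> WV [mem memE memV]; exists mem => // v /WV; exact: memV. Qed.

Lemma computesS n n' V V' W W' : (n <= n')%N -> V `<=` V' -> W' `<=` W ->
  computes n V W -> computes n' V' W'.
Proof.
move=> nn' VV' WW' c; split=> cs aV'.
have [cs' sz a] := computesP c (avail_sub VV' aV').
exists cs'; first exact: leq_trans nn'.
by apply: avail_cat => //; apply: avail_sub a => v /WW'; right.
Qed.

Lemma computesW n V W W' : W' `<=` W -> computes n V W -> computes n V W'.
Proof. exact: computesS. Qed.

Lemma computes0 V W : W `<=` V -> computes 0 V W.
Proof.
move=> WV; split=> cs a; exists [::] => //; rewrite cats0.
by apply: avail_sub a => v [//|/WV].
Qed.

(** Later steps may use everything that was available or computed before. *)
Lemma computes_trans n n' V W W' :
  computes n V W -> computes n' (V `|` W) W' -> computes (n + n') V W'.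
Proof.
move=> c c'; split=> cs aV; have [cs' sz a] := computesP c aV.
have [cs'' sz' a'] := computesP c' a; exists (cs' ++ cs'').
  by rewrite size_cat leq_add.
by rewrite catA; apply: avail_sub a' => v [?|?]; [left; left | right].
Qed.

Lemma computes_setU n n' V W W' :
  computes n V W -> computes n' V W' -> computes (n + n') V (W `|` W').
Proof.
move=> c c'; split=> cs aV; have [cs' sz a] := computesP c aV.
have c'' : computes n' (V `|` W) W' by apply: computesS c' => // v; left.
have [cs'' sz' a'] := computesP c'' a; exists (cs' ++ cs'').
  by rewrite size_cat leq_add.
by rewrite catA; apply: avail_sub a' => v;
  rewrite /setU /=; tauto.
Qed.

Lemma computes_seq n n' V W W' :
  computes n V W -> computes n' (V `|` W) W' -> computes (n + n') V (W `|` W').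
Proof.
move=> c c'; apply: (computes_trans c); rewrite -[n']add0n.
apply: computes_setU c'; apply: computes0 => v; by right.
Qed.

Lemma computes_bigcup n N V (W : nat -> set (X -> F)) :
  (forall i, (i < N)%N -> computes n V (W i)) ->
  computes (N * n) V (\bigcup_(i in `I_N) W i).
Proof.
elim: N => [|N IH] cW; first by rewrite II0 bigcup_set0; exact: computes0.
rewrite mulSnr IIS bigcup_setU bigcup_set1; apply: computes_setU; last exact: cW.
by apply: IH => i iN; apply: cW; exact: ltnW.
Qed.

Lemma computes_cst (a : F) V : computes 0 V [set fun=> a].
Proof.
split=> cs [mem memE memV]; exists [::] => //; rewrite cats0; exists mem => // v.
by move=> [/memV //|->]; exists (Cst I a).
Qed.

Lemma computes_inp (i : I) V : computes 0 V [set fun x => inp x i].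
Proof.
split=> cs [mem memE memV]; exists [::] => //; rewrite cats0; exists mem => // v.
by move=> [/memV //|->]; exists (Inp F i).
Qed.

Lemma computes_arith o (v w y : X -> F) V : V v -> V w ->
  (forall x, apply_arith o (v x) (w x) = Some (y x)) -> computes 1 V [set y].
Proof.
move=> Vv Vw yE; split=> cs aV; have [mem memE memV] := aV.
have [ov ovE] := memV v Vv; have [ow owE] := memV w Vw.
exists [:: Instr o ov ow] => //; apply: avail_cat aV _.
exists (fun x => rcons (mem x) (y x)) => [x|_ ->].
  by rewrite cats1 exec_rcons memE /= /step /= ovE owE yE.
(* one result per instruction: the new result has the same number for all x *)
exists (Res F I (size cs)) => x /=.
by rewrite -cats1 onth_cat (size_exec (memE x)) ltnn subnn.
Qed.

Lemma run_exec cs x mem op : exec cs x = Some mem ->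
  run (inp x) (Program cs op) = fetch (inp x) mem op.
Proof. by rewrite /run /exec /= => ->. Qed.

Lemma computes_add v w V : V v -> V w -> computes 1 V [set fun x => v x + w x].
Proof. by move=> Vv Vw; apply: (@computes_arith Add v w _ V Vv Vw). Qed.

Lemma computes_sub v w V : V v -> V w -> computes 1 V [set fun x => v x - w x].
Proof. by move=> Vv Vw; apply: (@computes_arith Defs.Sub v w _ V Vv Vw). Qed.

Lemma computes_mul v w V : V v -> V w -> computes 1 V [set fun x => v x * w x].
Proof. by move=> Vv Vw; apply: (@computes_arith Mul v w _ V Vv Vw). Qed.

Lemma computes_div v w V : (forall x, w x != 0) -> V v -> V w ->
  computes 1 V [set fun x => v x / w x].
Proof.
move=> w0 Vv Vw; apply: (@computes_arith Div v w _ V Vv Vw) => // x /=.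
by rewrite (negbTE (w0 x)).
Qed.

Lemma computes_scale (a : F) v V : V v -> computes 1 V [set fun x => v x * a].
Proof.
move=> Vv; apply: (@computes_trans 0 1 V _ _ (computes_cst a V)).
by apply: (@computes_mul v (fun=> a)); [left | right].
Qed.

Lemma computes_sum N (a : nat -> X -> F) V : (forall i, (i < N)%N -> V (a i)) ->
  computes N V [set fun x => \sum_(i < N) a i x].
Proof.
elim: N => [|N IH] Va.
  apply: computesW (computes_cst 0 V) => _ ->.
  by apply/funext => x; rewrite big_ord0.
have VN i : (i < N)%N -> V (a i) by move=> ?; apply: Va; exact: ltnW.
rewrite -[X in computes X]addn1; apply: (computes_trans (IH VN)).
set S := fun x => \sum_(i < N) a i x.
apply: computesW (@computes_add S (a N) (V `|` [set S]) _ _).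
- by move=> _ ->; apply/funext => x; rewrite big_ord_recr.
- by right.
- by left; exact: Va.
Qed.

End Circuits.

(** * Fast Fourier transforms *)

Lemma sum_parity (V : nmodType) (n : nat) (f : nat -> V) :
  \sum_(k < 2 * n) f k = \sum_(k < n) f (2 * k)%N + \sum_(k < n) f (2 * k).+1.
Proof.
elim: n => [|n IH]; first by rewrite muln0 !big_ord0 addr0.
rewrite mulnS !addSn add0n !big_ord_recr /= IH -!addrA; congr (_ + _).
by rewrite addrCA.
Qed.

Lemma sum_muln (V : nmodType) (p q : nat) (f : nat -> V) :
  \sum_(n < p * q) f n = \sum_(d < p) \sum_(n < q) f (n + q * d)%N.
Proof.
elim: p => [|p IH]; first by rewrite mul0n !big_ord0.
rewrite big_ord_recr /= -IH mulSnr big_split_ord /=; congr (_ + _).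
by apply: eq_bigr => n _; rewrite addnC mulnC.
Qed.

Section Fourier.
Variables (F : fieldType) (I X : Type) (inp : X -> I -> F).
Local Notation computes := (computes inp).

Definition dft (N : nat) (z : F) (a : nat -> X -> F) (r : nat) : X -> F :=
  fun x => \sum_(k < N) a k x * z ^+ (r * k).

(** Splitting the sum by the parity of [k] leaves two transforms of half the
    length for the root [z ^+ 2]. *)
Lemma computes_fft t (z : F) (a : nat -> X -> F) (V : set (X -> F)) :
  ((0 < t)%N -> z ^+ (2 ^ t.-1) = -1) ->
  (forall k, (k < 2 ^ t)%N -> V (a k)) ->
  computes (3 * t * 2 ^ t) V (dft (2 ^ t) z a @` `I_(2 ^ t)).
Proof.
elim: t z a V => [|t IH] z a V zE Va.
  rewrite muln0 mul0n; apply: computes0 => // v [[|//] _ <-].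
  rewrite [dft _ _ _ _](_ : _ = a 0%N); first exact: Va.
  by apply/funext => x; rewrite /dft big_ord1 muln0 mulr1.
have z2 : (0 < t)%N -> (z ^+ 2) ^+ (2 ^ t.-1) = -1.
  by move=> t0; rewrite -exprM -expnS prednK //; exact: zE.
have N2 : (2 ^ t.+1 = 2 * 2 ^ t)%N by rewrite expnS.
set a0 := fun k => a (2 * k)%N; set a1 := fun k => a (2 * k).+1.
have c0 : computes (3 * t * 2 ^ t) V (dft (2 ^ t) (z ^+ 2) a0 @` `I_(2 ^ t)).
  by apply: IH => // k kt; apply: Va; rewrite N2 ltn_pmul2l.
have c1 : computes (3 * t * 2 ^ t) V (dft (2 ^ t) (z ^+ 2) a1 @` `I_(2 ^ t)).
  apply: IH => // k kt; apply: Va; rewrite N2.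
  by rewrite -(ltn_pmul2l (isT : 0 < 2)%N) in kt; lia.
set W := _ @` _ in c0; set W' := _ @` _ in c1.
(* butterfly: both outputs r and r + 2^t for three operations *)
pose B r : set (X -> F) :=
  [set fun x => dft (2 ^ t) (z ^+ 2) a1 r x * z ^+ r] `|`
  ([set dft (2 ^ t.+1) z a r] `|` [set dft (2 ^ t.+1) z a (r + 2 ^ t)]).
have cB : computes (2 ^ t * 3) (V `|` (W `|` W')) (\bigcup_(r in `I_(2 ^ t)) B r).
  apply: computes_bigcup => r rt.
  set o := fun x => dft (2 ^ t) (z ^+ 2) a1 r x * z ^+ r.
  have W0 : W (dft (2 ^ t) (z ^+ 2) a0 r) by exists r.
  have W1 : W' (dft (2 ^ t) (z ^+ 2) a1 r) by exists r.
  have co : computes 1 (V `|` (W `|` W')) [set o].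
    by apply: computes_scale; right; right.
  have zz k : z ^+ (r * (2 * k)) = (z ^+ 2) ^+ (r * k).
    by rewrite -exprM; congr (_ ^+ _); lia.
  have zz1 k : z ^+ (r * (2 * k).+1) = (z ^+ 2) ^+ (r * k) * z ^+ r.
    by rewrite -exprM -exprD; congr (_ ^+ _); lia.
  have zt : z ^+ (2 ^ t) = -1 by exact: zE.
  have m1 k : z ^+ (2 ^ t * (2 * k)) = 1.
    by rewrite exprM zt exprM sqrrN !expr1n.
  have m1' k : z ^+ (2 ^ t * (2 * k).+1) = -1.
    by rewrite mulnS exprD m1 zt mulr1.
  have cE : dft (2 ^ t.+1) z a r =
      fun x => dft (2 ^ t) (z ^+ 2) a0 r x + o x.
    apply/funext => x; rewrite /dft N2.
    rewrite (sum_parity _ (fun k => a k x * z ^+ (r * k))); congr (_ + _).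
      by apply: eq_bigr => k _; rewrite zz.
    by rewrite /o /dft mulr_suml; apply: eq_bigr => k _; rewrite zz1 mulrA.
  have cE' : dft (2 ^ t.+1) z a (r + 2 ^ t) =
      fun x => dft (2 ^ t) (z ^+ 2) a0 r x - o x.
    apply/funext => x; rewrite /dft N2.
    rewrite (sum_parity _ (fun k => a k x * z ^+ ((r + 2 ^ t) * k))).
    congr (_ + _).
      apply: eq_bigr => k _; rewrite mulnDl exprD zz.
      by rewrite m1 mulr1.
    rewrite /o /dft mulr_suml -sumrN; apply: eq_bigr => k _.
    by rewrite mulnDl exprD zz1 m1' mulrN1 mulrN mulrA.
  apply: (computes_seq co); rewrite cE cE'; apply: (computes_setU (n := 1) (n' := 1)).
    by apply: computes_add; [left; right; left | right].
  by apply: computes_sub; [left; right; left | right].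
have c := computes_trans (computes_setU c0 c1) cB.
apply: computesS c => //.
- by rewrite N2; have := expn_gt0 2 t; nia.
- move=> v [r rt <-]; rewrite /= N2 in rt.
  have [rt'|rt'] := ltnP r (2 ^ t); first by exists r => //; right; left.
  exists (r - 2 ^ t)%N; first by rewrite /=; lia.
  by right; right; rewrite subnK.
Qed.

End Fourier.

Lemma sum_prim_root (F : fieldType) n (z : F) a b :
  n.-primitive_root z -> (a < n)%N -> (b < n)%N ->
  \sum_(r < n) (z ^+ a / z ^+ b) ^+ r = n%:R *+ (a == b).
Proof.
move=> pn an bn; have zn := prim_expr_order pn.
have z0 : z != 0.
  apply/eqP => z0; move: zn; rewrite z0 expr0n gtn_eqF ?(leq_ltn_trans _ an)//.
  by move/esym/eqP; rewrite oner_eq0.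
have [<-|ab] := eqVneq a b.
  rewrite divff ?expf_neq0//; under eq_bigr do rewrite expr1n.
  by rewrite sumr_const card_ord.
set y := _ / _.
have y1 : y != 1.
  apply/negP => /eqP y1; have /eqP : z ^+ a = z ^+ b.
    by rewrite -[RHS]mul1r -y1 divfK ?expf_neq0.
  by rewrite (eq_prim_root_expr pn) !modn_small// (negbTE ab).
have /eqP : (y - 1) * \sum_(r < n) y ^+ r = 0.
  rewrite -subrX1 /y expr_div_n -!exprM ![(_ * n)%N]mulnC !exprM zn.
  by rewrite !expr1n divr1 subrr.
by rewrite mulf_eq0 subr_eq0 (negbTE y1) => /eqP.
Qed.

Lemma pow2_prim_root (F : fieldType) t (z : F) : (0 < t)%N -> 2 != 0 :> F ->
  z ^+ (2 ^ t.-1) = -1 -> (2 ^ t).-primitive_root z.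
Proof.
case: t => // t _ two0 /= zE.
have zN : z ^+ (2 ^ t.+1) = 1 by rewrite expnS mulnC exprM zE sqrrN expr1n.
have [n pn ndvd] := prim_order_exists (expn_gt0 2 t.+1) zN.
have [e et nE] := dvdn_pfactor _ _ (isT : prime 2) ndvd.
move: et; rewrite leq_eqVlt ltnS => /predU1P[et|et]; first by rewrite -et -nE.
have : (n %| 2 ^ t)%N by rewrite nE dvdn_exp2l.
rewrite (prim_order_dvd pn) zE.
by rewrite -subr_eq0 -opprD oppr_eq0 (negbTE two0).
Qed.

Section Bluestein.
Variables (F : fieldType) (I X : Type) (inp : X -> I -> F).
Local Notation computes := (computes inp).

Lemma bin2D j k : 'C(j + k, 2) = ('C(j, 2) + 'C(k, 2) + j * k)%N.
Proof.
elim: j => [|j IH]; first by rewrite add0n mul0n addn0 bin0n.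
by rewrite addSn !binS !bin1 IH; lia.
Qed.

(** Bluestein's algorithm. As j k = C(j + k, 2) - C(j, 2) - C(k, 2), the
    transform is a correlation with the chirp w^C(l, 2) between two diagonal
    scalings. The correlation is a product between two transforms of length
    2^t, and 2 p <= 2^t keeps the indices j + k from wrapping around. Binomial
    coefficients in place of halved squares avoid a square root of [w]. *)
Lemma computes_dft (p t : nat) (z w : F) (a : nat -> X -> F) (V : set (X -> F)) :
  (2 * p <= 2 ^ t)%N -> (0 < t)%N -> z ^+ (2 ^ t.-1) = -1 ->
  2 != 0 :> F -> w != 0 ->
  (forall k, (k < p)%N -> V (a k)) ->
  computes (2 * p + (6 * t + 1) * 2 ^ t) V (dft p w a @` `I_p).
Proof.
move=> pt t0 zE two0 w0 Va; have pz := pow2_prim_root t0 two0 zE.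
pose ap k : X -> F := fun x => if (k < p)%N then a k x / w ^+ 'C(k, 2) else 0.
(* [bh] is the transform of the chirp for the inverse root, divided by the
   length: multiplying by it and transforming back is the correlation *)
pose bh r := \sum_(l < 2 ^ t) w ^+ 'C(l, 2) / z ^+ (r * l) / (2 ^ t)%:R.
pose y r : X -> F := fun x => dft (2 ^ t) z ap r x * bh r.
have cp : computes (p * 1) V (\bigcup_(k in `I_p) [set ap k]).
  apply: computes_bigcup => k kp.
  rewrite [ap k](_ : _ = fun x => a k x / w ^+ 'C(k, 2)).
    by apply: computes_scale; exact: Va.
  by apply/funext => x; rewrite /ap kp.
have c0 : computes 0 V [set fun=> 0] by exact: computes_cst.
have cf := @computes_fft F I X inp t z ap
  (V `|` (\bigcup_(k in `I_p) [set ap k] `|` [set fun=> 0])) (fun _ => zE).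
have {}cf := computes_trans (computes_setU cp c0) (cf _).
have {}cf : computes (p + 3 * t * 2 ^ t) V (dft (2 ^ t) z ap @` `I_(2 ^ t)).
  apply: computesS (cf _) => //; first by rewrite muln1 addn0.
  move=> k _; right; have [kp|pk] := ltnP k p; first by left; exists k.
  by right; apply/funext => x; rewrite /ap ltnNge pk.
have cy := @computes_bigcup F I X inp 1 (2 ^ t)
  (V `|` dft (2 ^ t) z ap @` `I_(2 ^ t)) (fun r => [set y r]).
have {}cy := computes_trans cf (cy _).
have {}cy : computes (p + 3 * t * 2 ^ t + 2 ^ t) V
    (\bigcup_(r in `I_(2 ^ t)) [set y r]).
  apply: computesS (cy _) => //; first by rewrite muln1.
  by move=> r rt; apply: computes_scale; right; exists r.
have cg := @computes_fft F I X inp t z y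
  (V `|` \bigcup_(r in `I_(2 ^ t)) [set y r]) (fun _ => zE).
have {}cg := computes_trans cy (cg _).
have {}cg : computes (p + 3 * t * 2 ^ t + 2 ^ t + 3 * t * 2 ^ t) V
    (dft (2 ^ t) z y @` `I_(2 ^ t)).
  by apply: computesS (cg _) => // k kt; right; exists k.
have ch := @computes_bigcup F I X inp 1 p
  (V `|` dft (2 ^ t) z y @` `I_(2 ^ t)) (fun j => [set dft p w a j]).
have {}ch := computes_trans cg (ch _).
apply: computesS (ch _) => //; first by nia.
- by move=> _ [j jp <-]; exists j.
- move=> j jp.
  suff -> : dft p w a j = fun x => dft (2 ^ t) z y j x / w ^+ 'C(j, 2).
    by apply: computes_scale; right; exists j => //=; lia.
  apply/funext => x; rewrite /dft /y.
  have N0 : (2 ^ t)%:R != 0 :> F by rewrite natrX expf_neq0.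
  have tN : (p <= 2 ^ t)%N by lia.
  have -> : \sum_(r < 2 ^ t) dft (2 ^ t) z ap r x * bh r * z ^+ (j * r) =
      \sum_(k < 2 ^ t) \sum_(l < 2 ^ t) ap k x * w ^+ 'C(l, 2) / (2 ^ t)%:R *
        \sum_(r < 2 ^ t) (z ^+ (j + k) / z ^+ l) ^+ r.
    under eq_bigr do rewrite /dft /bh 2!mulr_suml.
    rewrite exchange_big /=; apply: eq_bigr => k _.
    under eq_bigr do rewrite mulr_sumr mulr_suml.
    rewrite exchange_big /=; apply: eq_bigr => l _.
    rewrite mulr_sumr; apply: eq_bigr => r _.
    rewrite expr_div_n -!exprM mulnDl exprD.
    by rewrite [(j * r)%N]mulnC [(k * r)%N]mulnC [(l * r)%N]mulnC; ring.
  have -> : \sum_(k < 2 ^ t) \sum_(l < 2 ^ t)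
        ap k x * w ^+ 'C(l, 2) / (2 ^ t)%:R *
        \sum_(r < 2 ^ t) (z ^+ (j + k) / z ^+ l) ^+ r =
      \sum_(k < 2 ^ t | (k < p)%N) a k x / w ^+ 'C(k, 2) * w ^+ 'C(j + k, 2).
    rewrite [RHS]big_mkcond; apply: eq_bigr => k _; rewrite /ap.
    case: ifP => kp; last by rewrite big1 // => l _; rewrite !mul0r.
    have jk : (j + k < 2 ^ t)%N by rewrite /= in jp; lia.
    rewrite (bigD1 (Ordinal jk)) //= [X in _ + X]big1 => [|l lj].
      rewrite (sum_prim_root pz)// eqxx addr0 mulr1n.
      by rewrite -[RHS]mulr1 -[X in _ = _ * X](divff N0); ring.
    rewrite (sum_prim_root pz)// (_ : (j + k == l)%N = false) ?mulr0 //.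
    by apply/negbTE; apply: contra lj => /eqP e; apply/eqP/val_inj.
  rewrite -(big_ord_widen _ (fun k => a k x / w ^+ 'C(k, 2) * w ^+ 'C(j + k, 2)) tN).
  rewrite mulr_suml; apply: eq_bigr => k _.
  rewrite bin2D !exprD.
  have A : w ^+ 'C(k, 2) != 0 by rewrite expf_neq0.
  have B : w ^+ 'C(j, 2) != 0 by rewrite expf_neq0.
  by field; rewrite A B.
Qed.

End Bluestein.

Lemma digit_low p m n d i : (0 < p)%N -> (i < m)%N ->
  digit p (n + p ^ m * d) i = digit p n i.
Proof.
move=> p0 im; rewrite /digit addnC -(subnK (ltnW im)) expnD mulnAC.
rewrite divnMDl ?expn_gt0 ?p0//.
rewrite -(prednK (_ : 0 < m - i)%N) ?subn_gt0// expnS -mulnA.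
by rewrite -modnDml modnMr.
Qed.

Lemma digit_top p m n d : (0 < p)%N -> (n < p ^ m)%N -> (d < p)%N ->
  digit p (n + p ^ m * d) m = d.
Proof.
move=> p0 nm dp; rewrite /digit addnC mulnC divnMDl ?expn_gt0 ?p0//.
by rewrite divn_small// addn0 modn_small.
Qed.

Section MultiFourier.
Variables (F : fieldType) (I X : Type) (inp : X -> I -> F).
Local Notation computes := (computes inp).

(** The Fourier transform of (Z_p)^m, with vectors encoded by the digits of
    natural numbers. *)
Definition mdft (p m : nat) (w : F) (a : nat -> X -> F) (h : nat) : X -> F :=
  fun x => \sum_(n < p ^ m)
    a n x * w ^+ (\sum_(i < m) digit p n i * digit p h i)%N.

(** The top digit of the summation index is summed last. *)
Lemma mdftS p m w (a : nat -> X -> F) h e :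
  (0 < p)%N -> (h < p ^ m)%N -> (e < p)%N ->
  mdft p m.+1 w a (h + p ^ m * e) =
  dft p w (fun d => mdft p m w (fun n => a (n + p ^ m * d)%N) h) e.
Proof.
move=> p0 hm ep; apply/funext => x; rewrite /mdft /dft expnS.
rewrite (sum_muln p (p ^ m) (fun n => a n x *
  w ^+ (\sum_(i < m.+1) digit p n i * digit p (h + p ^ m * e) i)%N)).
apply: eq_bigr => d _; rewrite mulr_suml; apply: eq_bigr => n _.
rewrite big_ord_recr /= !digit_top// exprD [(d * e)%N]mulnC mulrA.
by under eq_bigr do rewrite !digit_low//.
Qed.

Lemma computes_mdft p w D : (0 < p)%N ->
  (forall a V, (forall k, (k < p)%N -> V (a k)) ->
     computes (p * D) V (dft p w a @` `I_p)) ->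
  forall m a V, (forall n, (n < p ^ m)%N -> V (a n)) ->
    computes (m * D * p ^ m) V (mdft p m w a @` `I_(p ^ m)).
Proof.
move=> p0 cD; elim=> [|m IH] a V Va.
  rewrite mul0n; apply: computes0 => v [[|//] _ <-].
  rewrite [mdft _ _ _ _ _](_ : _ = a 0%N); first exact: Va.
  by apply/funext => x; rewrite /mdft big_ord1 big_ord0 mulr1.
pose b d n := a (n + p ^ m * d)%N.
have c0 : computes (p * (m * D * p ^ m)) V
    (\bigcup_(d in `I_p) (mdft p m w (b d) @` `I_(p ^ m))).
  apply: computes_bigcup => d dp; apply: IH => n nm; apply: Va.
  by rewrite expnS; nia.
have c1 := @computes_bigcup F I X inp (p * D) (p ^ m) _
  (fun h => dft p w (fun d => mdft p m w (b d) h) @` `I_p).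
apply: computesS (computes_trans c0 (c1 _ _)) => //.
- by rewrite expnS; nia.
- move=> _ [h hp <-]; rewrite /= expnS in hp.
  have pm0 : (0 < p ^ m)%N by rewrite expn_gt0 p0.
  exists (h %% p ^ m)%N; first by rewrite /= ltn_pmod.
  exists (h %/ p ^ m)%N; first by rewrite /= ltn_divLR.
  rewrite -mdftS// ?ltn_pmod// ?ltn_divLR//.
  by rewrite addnC mulnC -divn_eq.
- move=> h hm; apply: cD => d dp; right; exists d => //; by exists h.
Qed.

Lemma pow2_root (t : nat) : (forall x : F, exists y, y ^+ 2 = x) ->
  exists z : F, z ^+ (2 ^ t) = -1.
Proof.
move=> sq; elim: t => [|t [z zE]]; first by exists (-1); rewrite expr1.
by have [y yz] := sq z; exists y; rewrite expnS exprM yz.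
Qed.

(** With L = trunc_log 2 p, the length 2^(L + 2) lies between 2 p and 4 p. The
    cost 2 p + (6 (L + 2) + 1) 4 p = (24 L + 54) p is at most 78 L p since
    1 <= L. *)
Lemma computes_prime_dft p w (a : nat -> X -> F) (V : set (X -> F)) :
  (forall x : F, exists y, y ^+ 2 = x) -> 2 != 0 :> F -> w != 0 ->
  (1 < p)%N -> (forall k, (k < p)%N -> V (a k)) ->
  computes (p * (78 * trunc_log 2 p)) V (dft p w a @` `I_p).
Proof.
move=> sq two0 w0 p1 Va; set L := trunc_log 2 p.
have [z zE] := pow2_root (L + 1) sq.
have pL : (p < 2 ^ L.+1)%N by exact: trunc_log_ltn.
have Lp : (2 ^ L <= p)%N by apply: trunc_logP => //; exact: ltnW.
have L0 : (0 < L)%N by rewrite trunc_log_gt0.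
have t4 : (2 ^ (L + 2) = 4 * 2 ^ L)%N by rewrite expnD mulnC.
rewrite expnS in pL.
have pt : (2 * p <= 2 ^ (L + 2))%N by rewrite t4; lia.
have t0 : (0 < L + 2)%N by rewrite addn2.
have zE' : z ^+ (2 ^ (L + 2).-1) = -1 by rewrite addn2 -zE addn1.
have c := computes_dft inp pt t0 zE' two0 w0 Va; apply: computesS c => //.
rewrite t4; set N := (2 ^ L)%N in Lp *.
have : ((6 * (L + 2) + 1) * (4 * N) <= (6 * (L + 2) + 1) * (4 * p))%N.
  by rewrite !leq_mul2l Lp !orbT.
have : (p <= p * L)%N by rewrite leq_pmulr.
by lia.
Qed.

End MultiFourier.

(** * Walsh functions and Dirichlet kernels *)

Section Omega.
Variables (R : realType) (p : nat).
Local Notation w := (omega R p).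

Lemma conj_omegaE (z : R[i]) : Num.conj z = conjc z.
Proof. by []. Qed.

Lemma omega_exp n :
  w ^+ n = Complex (cos (2 * pi / p%:R *+ n)) (sin (2 * pi / p%:R *+ n)).
Proof.
elim: n => [|n IH]; first by rewrite expr0 !mulr0n cos0 sin0.
rewrite exprSr IH /omega; set t := 2 * pi / _.
rewrite [t *+ n.+1]mulrSr cosD sinD; apply/eqP.
by rewrite eq_complex /= eqxx addrC eqxx.
Qed.

Lemma omega_p : (0 < p)%N -> w ^+ p = 1.
Proof.
move=> p0; rewrite omega_exp -mulr_natr divfK ?pnatr_eq0 -?lt0n//.
by rewrite mulr_natl cos2pi sin2pi.
Qed.

Lemma omega_neq1 : (1 < p)%N -> w != 1.
Proof.
move=> p1; apply/eqP => -[c1 _]; move: c1.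
have -> : 2 * pi / p%:R = (pi / p%:R) *+ 2 :> R by rewrite -mulrA mulr_natl.
have p0 : 0 < p%:R :> R by rewrite ltr0n ltnW.
rewrite cos_mulr2n => c1; have /eqP : sin (pi / p%:R : R) ^+ 2 = 0.
  by have := cos2Dsin2 (pi / p%:R : R); lra.
rewrite sqrf_eq0 => /eqP s0.
have := @sin_gt0_pi R (pi / p%:R); rewrite s0 ltxx => /(_ _) // h.
suff : false by []; apply: h.
by rewrite divr_gt0 ?pi_gt0//= ltr_pdivrMr// ltr_pMr ?pi_gt0// ltr1n.
Qed.

Lemma omega_prim : prime p -> p.-primitive_root w.
Proof.
move=> pp; have [n pn nd] := prim_order_exists (prime_gt0 pp) (omega_p (prime_gt0 pp)).
have [_ /(_ _ nd)/orP[]/eqP nE] := primeP pp.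
  move: (prim_expr_order pn); rewrite nE expr1 => /eqP.
  by rewrite (negbTE (omega_neq1 (prime_gt1 pp))).
by move: pn; rewrite nE.
Qed.

Lemma norm_omega : `|w| = 1.
Proof.
rewrite normc_def /= cos2Dsin2 sqrtr1; exact: rmorph1.
Qed.

Lemma omega_neq0 : w != 0.
Proof. by rewrite -normr_eq0 norm_omega oner_eq0. Qed.

Lemma conj_omega : Num.conj w = w^-1.
Proof.
apply: (mulfI omega_neq0); rewrite divff ?omega_neq0//.
by rewrite -normCK norm_omega expr1n.
Qed.

Lemma omega_orth a b : prime p -> (a < p)%N -> (b < p)%N ->
  \sum_(d < p) w ^+ (a * d) * Num.conj (w ^+ (b * d)) = p%:R *+ (a == b).
Proof.
move=> pp ap bp.
have -> : \sum_(d < p) w ^+ (a * d) * Num.conj (w ^+ (b * d)) =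
    \sum_(d < p) (w ^+ a / w ^+ b) ^+ d.
  apply: eq_bigr => d _.
  by rewrite rmorphXn /= conj_omega exprVn expr_div_n -!exprM.
exact: (sum_prim_root (omega_prim pp)).
Qed.

End Omega.

Section Walsh.
Variables (R : realType) (p : nat).
Hypothesis pp : prime p.
Let p1 : (1 < p)%N := prime_gt1 pp.
Let p0 : (0 < p)%N := prime_gt0 pp.
Implicit Types (x y z : R).

Lemma xdigit_lt x i : (xdigit p x i < p)%N.
Proof.
rewrite /xdigit -ltz_nat gez0_abs ?modz_ge0//; first by rewrite ltz_pmod.
by rewrite eqz_nat -lt0n.
Qed.

Lemma digit_ge k a : (k < p ^ a)%N -> digit p k a = 0%N.
Proof. by move=> ka; rewrite /digit divn_small// mod0n. Qed.

Lemma nu1_le k a : (k < p ^ a)%N -> (nu1 p k <= a)%N.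
Proof.
move=> ka; apply/bigmax_leqP => i; apply: contraR; rewrite -ltnNge ltnS => ai.
by rewrite digit_ge// (leq_trans ka)// leq_pexp2l.
Qed.

Lemma digit_ge_nu1 k i : (nu1 p k <= i)%N -> digit p k i = 0%N.
Proof.
move=> ki; apply/eqP; apply: contraTT (ki) => di; rewrite -ltnNge.
have ik : (i < k)%N.
  rewrite ltnNge; apply: contra di => ki'; rewrite digit_ge//.
  by rewrite (leq_ltn_trans ki')// ltn_expl.
exact: (@leq_bigmax_cond _ _ (fun i : 'I_k => i.+1) (Ordinal ik)).
Qed.

Lemma nu1E k a : (p ^ a <= k < p ^ a.+1)%N -> nu1 p k = a.+1.
Proof.
move=> /andP[ak ka]; apply/eqP; rewrite eqn_leq nu1_le//=.
rewrite ltnNge; apply/negP => /digit_ge_nu1; rewrite /digit modn_small.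
  by apply/eqP; rewrite -lt0n divn_gt0// expn_gt0 p0.
by rewrite ltn_divLR ?expn_gt0 ?p0// -expnS.
Qed.

(** Leading zero digits do not contribute. *)
Lemma wal1E k x a : (k < p ^ a)%N ->
  wal1 p k x = omega R p ^+ (\sum_(i < a) xdigit p x i * digit p k i)%N.
Proof.
move=> /nu1_le ka; rewrite /wal1; congr (_ ^+ _).
rewrite (big_ord_widen _ (fun i => xdigit p x i * digit p k i)%N ka).
rewrite big_mkcond; apply: eq_bigr => i _; case: ltnP => // /digit_ge_nu1 ->.
by rewrite muln0.
Qed.

Lemma norm_wal1 k x : `|wal1 p k x| = 1.
Proof. by rewrite /wal1 normrX norm_omega expr1n. Qed.

Lemma wal1_add x a n d : (n < p ^ a)%N -> (d < p)%N ->
  wal1 p (n + p ^ a * d) x = wal1 p n x * omega R p ^+ (xdigit p x a * d).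
Proof.
move=> na dp; rewrite (@wal1E _ x a.+1); last by rewrite expnS; nia.
rewrite (wal1E _ na) big_ord_recr /= digit_top// exprD.
by under eq_bigr do rewrite digit_low//.
Qed.

Fixpoint agree a x y : bool :=
  if a is a'.+1 then agree a' x y && (xdigit p x a' == xdigit p y a') else true.

(** The Walsh-Dirichlet kernel. *)
Definition dirichlet a x y : R := (p ^ a * agree a x y)%:R.

(** By induction on the number of digits: the sum over the top digit of k is the
    orthogonality relation of the characters of Z_p. *)
Lemma dirichletE a x y :
  \sum_(k < p ^ a) wal1 p k x * Num.conj (wal1 p k y) = (dirichlet a x y)%:C%C.
Proof.
rewrite /dirichlet (rmorph_nat (real_complex R)).
elim: a => [|a IH].
  rewrite big_ord1 (@wal1E 0%N x 0)// (@wal1E 0%N y 0)// !big_ord0 expr0.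
  by rewrite conj_omegaE rmorph1 mulr1.
rewrite expnS (sum_muln p (p ^ a) (fun k => wal1 p k x * Num.conj (wal1 p k y))).
rewrite exchange_big /=.
under eq_bigr => n _.
  under eq_bigr => d _.
    rewrite !wal1_add// rmorphM mulrACA.
    over.
  rewrite -mulr_sumr omega_orth ?xdigit_lt//.
  over.
rewrite -mulr_suml IH; case: agree => /=; last by rewrite !muln0 mul0r.
by case: eqP => _; rewrite ?muln0 ?mulr0n ?mulr0// !muln1 mulr1n -natrM mulnC.
Qed.

End Walsh.

(** * Summation of the Walsh series *)

Section Series.
Variables (R : realType) (p : nat).
Hypothesis pp : prime p.
Let p1 : (1 < p)%N := prime_gt1 pp.
Let p0 : (0 < p)%N := prime_gt0 pp.
Implicit Types (c q x y z : R).

(** The wavenumbers with exactly a + 1 digits share the coefficient c q^a, and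
    their Walsh functions add up to a difference of two Dirichlet kernels. *)
Definition kterm c q x y (a : nat) : R :=
  c * q ^+ a * (dirichlet p a.+1 x y - dirichlet p a x y).

Definition kernel1 c q x y : R := limn (series (kterm c q x y)).

Lemma dirichlet_ge0 a x y : 0 <= dirichlet p a x y.
Proof. exact: ler0n. Qed.

Lemma dirichlet_le a x y : dirichlet p a x y <= (p ^ a)%:R.
Proof. by rewrite ler_nat; case: agree; rewrite ?muln1 ?muln0. Qed.

Lemma kterm_le c q x y a : 0 <= c -> 0 <= q ->
  `|kterm c q x y a| <= geometric (c * p%:R) (p%:R * q) a.
Proof.
move=> c0 q0; have cq : 0 <= c * q ^+ a by rewrite mulr_ge0 ?exprn_ge0.
rewrite /kterm normrM ger0_norm//.
have -> : geometric (c * p%:R) (p%:R * q) a = c * q ^+ a * (p ^ a.+1)%:R.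
  by rewrite /= natrX exprS exprMn; ring.
rewrite ler_wpM2l// ler_norml.
have := dirichlet_ge0 a x y; have := dirichlet_ge0 a.+1 x y.
have := dirichlet_le a x y; have := dirichlet_le a.+1 x y.
have : (p ^ a)%:R <= (p ^ a.+1)%:R :> R by rewrite ler_nat leq_exp2l.
by move=> *; apply/andP; split; lra.
Qed.

Lemma cvg_kterm c q x y : 0 <= c -> 0 <= q -> p%:R * q < 1 ->
  cvgn (series (kterm c q x y)).
Proof.
move=> c0 q0 pq; apply: normed_cvg.
apply: (@series_le_cvg _ _ (geometric (c * p%:R) (p%:R * q))) => [n|n|n|].
- exact: normr_ge0.
- by rewrite /= mulr_ge0 ?exprn_ge0 ?mulr_ge0.
- exact: kterm_le.
- by apply: is_cvg_geometric_series; rewrite ger0_norm// mulr_ge0.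
Qed.

Lemma kernel1_cvg c q x y : 0 <= c -> 0 <= q -> p%:R * q < 1 ->
  series (kterm c q x y) n @[n --> \oo] --> kernel1 c q x y.
Proof. exact: cvg_kterm. Qed.

Definition psum (w : nat -> R) x y N : R[i] :=
  \sum_(1 <= k < N) ((w k)%:C%C * wal1 p k x * Num.conj (wal1 p k y)).

Lemma psum_expn c q w x y M :
  (forall k, (0 < k)%N -> w k = c * q ^+ (nu1 p k).-1) ->
  psum w x y (p ^ M) = (series (kterm c q x y) M)%:C%C.
Proof.
move=> wE; elim: M => [|M IH].
  by rewrite /psum expn0 big_geq// /series /= big_geq// rmorph0.
have pM0 : (0 < p ^ M)%N by rewrite expn_gt0 p0.
have pMM : (p ^ M <= p ^ M.+1)%N by rewrite leq_exp2l.
rewrite /psum (big_cat_nat pM0 pMM) -/(psum w x y (p ^ M)) IH /=.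
rewrite /series /= big_nat_recr//= rmorphD; congr (_ + _).
rewrite (@eq_big_nat _ _ _ _ _ _ (fun k => (c * q ^+ M)%:C%C *
    (wal1 p k x * Num.conj (wal1 p k y)))); last first.
  move=> k kM; rewrite wE ?(nu1E pp kM)// ?mulrA//.
  by case/andP: kM => /(leq_trans pM0).
rewrite -mulr_sumr /kterm [in RHS]rmorphM; congr (_ * _).
rewrite rmorphB /= -!(dirichletE pp).
rewrite -!(big_mkord xpredT (fun k => wal1 p k x * Num.conj (wal1 p k y))).
by rewrite (big_cat_nat (leq0n _) pMM) /= addrAC subrr add0r.
Qed.

(** There are fewer than p^(M + 1) terms, each of modulus c q^M. *)
Lemma psum_near c q w x y N M : 0 <= c -> 0 <= q ->
  (forall k, (0 < k)%N -> w k = c * q ^+ (nu1 p k).-1) ->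
  (p ^ M <= N < p ^ M.+1)%N ->
  `|psum w x y N - psum w x y (p ^ M)| <= (geometric (c * p%:R) (p%:R * q) M)%:C%C.
Proof.
move=> c0 q0 wE /andP[MN NM].
have pM0 : (0 < p ^ M)%N by rewrite expn_gt0 p0.
rewrite {1}/psum (big_cat_nat pM0 MN) -/(psum w x y (p ^ M)) /= addrAC subrr add0r.
have [cq pq] : 0 <= c * q ^+ M /\ 0 <= p%:R * q by split; rewrite mulr_ge0 ?exprn_ge0.
apply: (le_trans (ler_norm_sum _ _ _)).
rewrite (@eq_big_nat _ _ _ _ _ _ (fun k => (c * q ^+ M)%:C%C)); last first.
  move=> k /andP[Mk kN]; rewrite !normrM norm_wal1 norm_conjC norm_wal1 !mulr1.
  rewrite wE ?(leq_trans pM0)// (@nu1E _ pp _ M) ?Mk ?(ltn_trans kN)//=.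
  by rewrite ger0_norm// ler0c.
rewrite sumr_const_nat -(rmorphMn (real_complex R)) lecR -mulr_natr.
have gE : geometric (c * p%:R) (p%:R * q) M = c * q ^+ M * (p ^ M.+1)%:R.
  by rewrite /= natrX exprS exprMn; ring.
by rewrite [leRHS]gE ler_wpM2l// ler_nat (leq_trans (leq_subr _ _))// ltnW.
Qed.

(** Along the powers of p the partial sums are those of [kernel1]; between two
    powers they move by no more than a null sequence. *)
Lemma walsh_seriesE c q w x y : 0 <= c -> 0 <= q -> p%:R * q < 1 ->
  (forall k, (0 < k)%N -> w k = c * q ^+ (nu1 p k).-1) ->
  walsh_series p w x y = (kernel1 c q x y)%:C%C.
Proof.
move=> c0 q0 pq wE; rewrite /walsh_series -/(psum w x y).
apply: cvg_lim; first exact: norm_hausdorff.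
apply/cvgrPdist_lt => eps eps0.
have e0 : 0 < complex.Re eps by move: eps0; rewrite ltcE => /andP[].
have epsE : eps = (complex.Re eps)%:C%C by rewrite RRe_real// gtr0_real.
set e := complex.Re eps in e0 epsE.
have e20 : 0 < e / 2 by rewrite divr_gt0.
have /cvgrPdist_lt/(_ _ e20) [M0 _ h0] := @kernel1_cvg c q x y c0 q0 pq.
have pq' : `|p%:R * q| < 1 by rewrite ger0_norm// mulr_ge0.
have /cvgrPdist_lt/(_ _ e20) [M1 _ h1] := cvg_geometric (c * p%:R) pq'.
exists (p ^ maxn M0 M1)%N => // N; rewrite /= => MN.
have N0 : (0 < N)%N by rewrite (leq_trans _ MN)// expn_gt0 p0.
have := trunc_log_bounds p1 N0; set M := trunc_log p N => MNM.
have : (maxn M0 M1 <= M)%N by apply: trunc_log_max.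
rewrite geq_max => /andP[M0M M1M].
have := h0 M M0M; have := h1 M M1M; rewrite /= sub0r normrN => g1 g0.
rewrite -(subrKA (psum w x y (p ^ M))) (le_lt_trans (ler_normD _ _))//.
rewrite [ltRHS]epsE (splitr e) rmorphD ltrD//.
  by rewrite (psum_expn x y M wE) -rmorphB normc_def /= expr0n addr0 sqrtr_sqr ltcR.
rewrite distrC (le_lt_trans (psum_near _ _ c0 q0 wE MNM))// ltcR.
by rewrite (le_lt_trans (ler_norm _)).
Qed.

End Series.

(** * The kernels on points with finitely many digits *)

Section NetDigits.
Variables (R : realType) (p : nat).
Hypothesis pp : prime p.
Let p1 : (1 < p)%N := prime_gt1 pp.
Let p0 : (0 < p)%N := prime_gt0 pp.
Let pR0 : 0 < p%:R :> R. Proof. by rewrite ltr0n. Qed.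

Lemma expansion_lt1 (y : nat -> nat) M : (forall l, (y l < p)%N) ->
  0 <= (\sum_(l < M) (y l)%:R / p%:R ^+ l.+1 : R) < 1.
Proof.
move=> yp; apply/andP; split.
  by apply: sumr_ge0 => l _; rewrite divr_ge0// exprn_ge0.
have : \sum_(l < M) (y l)%:R / p%:R ^+ l.+1 <= 1 - p%:R ^- M :> R.
  elim: M => [|M IH]; first by rewrite big_ord0 expr0 invr1 subrr.
  rewrite big_ord_recr /= (le_trans (lerD IH (lexx _)))//.
  have -> : p%:R ^- M = p%:R / p%:R ^+ M.+1 :> R.
    by rewrite exprS invfM mulrA divff ?mul1r// gt_eqF.
  have : 0 < (p%:R ^+ M.+1)^-1 :> R by rewrite invr_gt0 exprn_gt0.
  have : (y M)%:R + 1 <= p%:R :> R by rewrite natr1 ler_nat.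
  by nra.
by move/le_lt_trans; apply; rewrite gtrBl invr_gt0 exprn_gt0.
Qed.

(** Multiplying by p^(i+1) makes the first i+1 digits the integral part. *)
Lemma xdigit_expansion (y : nat -> nat) M i : (forall l, (y l < p)%N) ->
  (i < M)%N -> xdigit p (\sum_(l < M) (y l)%:R / p%:R ^+ l.+1 : R) i = y i.
Proof.
move=> yp iM; rewrite /xdigit.
set A := (\sum_(l < i.+1) y l * p ^ (i - l))%N.
set t : R := \sum_(l < M - i.+1) (y (i.+1 + l))%:R / p%:R ^+ l.+1.
have -> : (\sum_(l < M) (y l)%:R / p%:R ^+ l.+1) * p%:R ^+ i.+1 =
    A%:R + t :> R.
  have fS (f : nat -> R) : \sum_(l < M) f l =
      \sum_(l < i.+1) f l + \sum_(l < M - i.+1) f (i.+1 + l)%N.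
    by rewrite -[in LHS](subnKC iM) big_split_ord.
  rewrite (fS (fun l => (y l)%:R / p%:R ^+ l.+1)) mulrDl; congr (_ + _).
    rewrite mulr_suml natr_sum; apply: eq_bigr => l _.
    have li : (l <= i)%N by rewrite -ltnS.
    have e : p%:R ^+ i.+1 = p%:R ^+ (i - l) * p%:R ^+ l.+1 :> R.
      by rewrite -exprD addnS subnK.
    by rewrite natrM natrX e mulrCA divfK ?expf_neq0 ?gt_eqF// mulrC.
  rewrite mulr_suml; apply: eq_bigr => l _.
  by rewrite -addnS exprD invfM mulrA mulrAC divfK ?expf_neq0 ?gt_eqF.
have /andP[t0 t1] := expansion_lt1 (M - i.+1) (fun l => yp (i.+1 + l)%N).
rewrite (@floor_def _ _ A%:Z); last first.
  by rewrite intrD -!pmulrn lerDl t0 ltrD2l t1.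
have -> : A = (p * (\sum_(l < i) y l * p ^ (i - l.+1)) + y i)%N.
  rewrite /A big_ord_recr /= subnn expn0 muln1 big_distrr /=; congr addn.
  by apply: eq_bigr => l _; rewrite mulnCA -expnS subnSK.
by rewrite modz_nat absz_nat mulnC modnMDl modn_small.
Qed.

Variables (m s : nat) (C : 'I_s -> 'M['F_p]_m).

Lemma Fp_lt (a : 'F_p) : (a < p)%N.
Proof. by rewrite -[X in (_ < X)%N](Fp_cast pp). Qed.

Definition netdigit n j (i : nat) : nat :=
  if insub i is Some i' then (C j *m dvec p m n) i' 0 else 0%N.

Lemma xdigit_netptE n j i : xdigit p (netpt R C n j) i = netdigit n j i.
Proof.
set y := netdigit n j.
have yp l : (y l < p)%N by rewrite /y /netdigit; case: insubP => // *; exact: Fp_lt.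
have y0 l : (m <= l)%N -> y l = 0%N.
  by move=> ml; rewrite /y /netdigit; case: insubP => // i'; rewrite ltnNge ml.
(* padding with zero digits makes the expansion long enough to contain i *)
have -> : netpt R C n j = \sum_(l < m + i.+1) (y l)%:R / p%:R ^+ l.+1.
  have -> : netpt R C n j = \sum_(l < m) (y l)%:R / p%:R ^+ l.+1.
    by apply: eq_bigr => l _; rewrite /y /netdigit valK.
  rewrite (big_ord_widen (m + i.+1) (fun l => (y l)%:R / p%:R ^+ l.+1 : R)) ?leq_addr//.
  rewrite big_mkcond; apply: eq_bigr => l _; case: ltnP => // /y0 ->.
  by rewrite mul0r.
by rewrite xdigit_expansion// ltn_addl.
Qed.

Lemma xdigit_netpt n j (i : 'I_m) :
  xdigit p (netpt R C n j) i = (C j *m dvec p m n) i 0.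
Proof. by rewrite xdigit_netptE /netdigit valK. Qed.

Lemma xdigit_netpt_ge n j i : (m <= i)%N -> xdigit p (netpt R C n j) i = 0%N.
Proof.
by move=> mi; rewrite xdigit_netptE /netdigit; case: insubP => // i'; rewrite ltnNge mi.
Qed.

End NetDigits.

Section KernelFourier.
Variables (R : realType) (p : nat).
Hypothesis pp : prime p.
Let p1 : (1 < p)%N := prime_gt1 pp.
Let p0 : (0 < p)%N := prime_gt0 pp.
Implicit Types (c q x y : R).

Lemma dirichlet_tail m x y i :
  (forall l, (m <= l)%N -> xdigit p x l = xdigit p y l) ->
  dirichlet p (m + i) x y = p%:R ^+ i * dirichlet p m x y.
Proof.
move=> xy; rewrite /dirichlet -natrX -natrM; congr _%:R.
rewrite expnD mulnA [(p ^ i * _)%N]mulnC -!mulnA; congr (_ * (_ * _))%N; congr nat_of_bool.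
elim: i => [|i IH]; first by rewrite addn0.
by rewrite addnS /= IH xy ?leq_addr// eqxx andbT.
Qed.

(** The first summand is the sum of the coefficients c q^a over all wavenumbers
    from p^m on in one residue class modulo p^m: (p - 1) p^(a - m) of them have
    a + 1 digits. *)
Definition bcoef c q m (k : nat) : R :=
  c * (p%:R - 1) * q ^+ m / (1 - p%:R * q) +
  (if k is 0 then 0 else c * q ^+ (nu1 p k).-1).

Lemma bcoef_gt0 c q m k : 0 < c -> 0 < q -> p%:R * q < 1 -> 0 < bcoef c q m k.
Proof.
move=> c0 q0 pq; rewrite ltr_wpDr//.
  by case: k => // k; rewrite mulr_ge0 ?exprn_ge0// ltW.
by rewrite divr_gt0 ?mulr_gt0 ?exprn_gt0 ?subr_gt0// ltr1n.
Qed.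

(** Digits shared by [x] and [y] cancel in the product of the Walsh functions,
    so that wavenumbers which agree modulo p^m contribute together. *)
Lemma kernel1_fourier c q m x y : 0 <= c -> 0 <= q -> p%:R * q < 1 ->
  (forall l, (m <= l)%N -> xdigit p x l = xdigit p y l) ->
  (kernel1 p c q x y)%:C%C = \sum_(k < p ^ m)
     (bcoef c q m k)%:C%C * (wal1 p k x * Num.conj (wal1 p k y)).
Proof.
move=> c0 q0 pq xy.
pose T := c * (p%:R - 1) * q ^+ m / (1 - p%:R * q).
have kE : kernel1 p c q x y = series (kterm p c q x y) m + T * dirichlet p m x y.
  apply: cvg_lim => //; rewrite -(cvg_shiftn m).
  have -> : [sequence series (kterm p c q x y) (n + m)%N]_n =
      (fun n => series (kterm p c q x y) m +
        series (geometric (c * q ^+ m * (p%:R - 1) * dirichlet p m x y) (p%:R * q)) n).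
    apply/funext => n; rewrite /= /series /= addnC.
    rewrite (big_cat_nat (leq0n m) (leq_addr n m)) /=; congr (_ + _).
    rewrite -{1}(add0n m) big_addn addKn; apply: eq_big_nat => i _.
    rewrite /kterm addnC -addnS !dirichlet_tail// exprD exprS exprMn; ring.
  apply: cvgD; first exact: cvg_cst.
  rewrite (_ : T * _ = c * q ^+ m * (p%:R - 1) * dirichlet p m x y / (1 - p%:R * q)).
    by apply: cvg_geometric_series; rewrite ger0_norm// mulr_ge0.
  by rewrite /T; ring.
rewrite kE rmorphD rmorphM /=.
pose w k := c * q ^+ (nu1 p k).-1.
rewrite -(@psum_expn _ _ pp c q w)// -dirichletE//.
under [RHS]eq_bigr do rewrite /bcoef -/T rmorphD mulrDl.
rewrite big_split /= [RHS]addrC mulr_sumr; congr (_ + _).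
rewrite -(big_mkord xpredT (fun k =>
  (if k is 0 then 0 else c * q ^+ (nu1 p k).-1)%:C%C * (wal1 p k x * Num.conj (wal1 p k y)))).
rewrite big_ltn ?expn_gt0 ?p0//= rmorph0 mul0r add0r /psum.
by apply: eq_big_nat => -[//|k] _; rewrite mulrA.
Qed.

Variable alpha : R.
Hypothesis alpha1 : 1 < alpha.

Definition Kc : R := (p%:R `^ alpha - p%:R) / (p%:R `^ alpha * (p%:R - 1)).
Definition Kq : R := p%:R `^ (- alpha).

Lemma KhatE k : Khat p alpha k = Kc * Kq ^+ (nu1 p k).-1.
Proof.
rewrite /Khat -/Kc; congr (_ * _).
by rewrite -mulNr powRrM powR_mulrn// powR_ge0.
Qed.

Lemma lt_p_powR : p%:R < p%:R `^ alpha.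
Proof.
have pR0 : 0 < p%:R :> R by rewrite ltr0n.
rewrite /powR gt_eqF// -[X in X < _]lnK ?posrE// ltr_expR.
by rewrite ltr_pMl// ln_gt0// ltr1n.
Qed.

Lemma Kc_gt0 : 0 < Kc.
Proof.
by rewrite divr_gt0 ?subr_gt0 ?lt_p_powR// mulr_gt0 ?subr_gt0 ?ltr1n// powR_gt0// ltr0n.
Qed.

Lemma Kq_gt0 : 0 < Kq. Proof. by rewrite powR_gt0// ltr0n. Qed.

Lemma Kq_lt1 : p%:R * Kq < 1.
Proof.
by rewrite /Kq powRN ltr_pdivrMr ?powR_gt0 ?ltr0n// mul1r lt_p_powR.
Qed.

Lemma Kq2_lt1 : p%:R * Kq ^+ 2 < 1.
Proof.
have q0 := Kq_gt0; have pq := Kq_lt1.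
have p1R : 1 < p%:R :> R by rewrite ltr1n.
by nra.
Qed.

Lemma K1E x y : K1 p alpha x y = (kernel1 p Kc Kq x y)%:C%C.
Proof.
apply: walsh_seriesE => // [|||k _]; rewrite ?ltW ?Kc_gt0 ?Kq_gt0 ?Kq_lt1//.
exact: KhatE.
Qed.

Lemma R1E x y : R1 p alpha x y = (kernel1 p (Kc ^+ 2) (Kq ^+ 2) x y)%:C%C.
Proof.
apply: walsh_seriesE => // [|||k _]; rewrite ?exprn_ge0 ?ltW ?Kc_gt0 ?Kq_gt0 ?Kq2_lt1//.
by rewrite KhatE exprMn exprAC.
Qed.

End KernelFourier.

(** * Integration over the unit interval *)

Section UnitInterval.
Variable (R : realType).
Local Notation mu := (@lebesgue_measure R).
Implicit Types (g h : R -> R).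

Definition int01 g : R := \int[mu]_(x in `[0, 1]) g x.

Definition bmeas g : Prop :=
  measurable_fun setT g /\ exists B, forall x, `|g x| <= B.

Lemma bmeas_cst (a : R) : bmeas (fun=> a).
Proof. by split; [exact: measurable_cst | exists `|a|]. Qed.

Lemma bmeasD g h : bmeas g -> bmeas h -> bmeas (fun x => g x + h x).
Proof.
move=> [mg [B gB]] [mh [B' hB]]; split; first exact: measurable_funD.
by exists (B + B') => x; rewrite (le_trans (ler_normD _ _))// lerD.
Qed.

Lemma bmeasM g h : bmeas g -> bmeas h -> bmeas (fun x => g x * h x).
Proof.
move=> [mg [B gB]] [mh [B' hB]]; split; first exact: measurable_funM.
by exists (B * B') => x; rewrite normrM ler_pM.
Qed.

Lemma bmeasZ a g : bmeas g -> bmeas (fun x => a * g x).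
Proof. by apply: bmeasM; exact: bmeas_cst. Qed.

Lemma bmeasB g h : bmeas g -> bmeas h -> bmeas (fun x => g x - h x).
Proof.
move=> ng nh; rewrite (_ : (fun _ => _) = (fun x => g x + -1 * h x)).
  by apply: bmeasD => //; exact: bmeasZ.
by apply/funext => x; rewrite mulN1r.
Qed.

Lemma bmeas_sum I (r : seq I) (P : pred I) (g : I -> R -> R) :
  (forall i, bmeas (g i)) -> bmeas (fun x => \sum_(i <- r | P i) g i x).
Proof.
move=> gi; elim: r => [|i r IH].
  by under eq_fun do rewrite big_nil; exact: bmeas_cst.
under eq_fun do rewrite big_cons; case: (P i) => //; exact: bmeasD.
Qed.

Lemma lebesgue01 : mu `[0%R, 1%R]%classic = 1%E.
Proof. by rewrite lebesgue_measure_itv /= lte_fin ltr01 oppr0 adde0. Qed.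

Lemma bmeas_integrable g : bmeas g -> mu.-integrable `[0, 1] (EFin \o g).
Proof.
move=> [mg [B gB]]; apply: measurable_bounded_integrable => //.
- by rewrite [X in (X < _)%E]lebesgue01 ltry.
- exact: measurable_funTS.
- by exists B; split; [exact: num_real | move=> M BM x _; exact: le_trans (gB x) (ltW BM)].
Qed.

Lemma int01_cst a : int01 (fun=> a) = a.
Proof. by rewrite /int01 Rintegral_cst// [X in fine X]lebesgue01 mulr1. Qed.

Lemma int01D g h : bmeas g -> bmeas h ->
  int01 (fun x => g x + h x) = int01 g + int01 h.
Proof. by move=> ng nh; rewrite /int01 RintegralD//; exact: bmeas_integrable. Qed.

Lemma int01Z a g : bmeas g -> int01 (fun x => a * g x) = a * int01 g.
Proof. by move=> ng; rewrite /int01 RintegralZl//; exact: bmeas_integrable. Qed.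

Lemma int01B g h : bmeas g -> bmeas h ->
  int01 (fun x => g x - h x) = int01 g - int01 h.
Proof. by move=> ng nh; rewrite /int01 RintegralB//; exact: bmeas_integrable. Qed.

Lemma int01_sum I (r : seq I) (P : pred I) (g : I -> R -> R) :
  (forall i, bmeas (g i)) ->
  int01 (fun x => \sum_(i <- r | P i) g i x) = \sum_(i <- r | P i) int01 (g i).
Proof.
move=> gi; elim: r => [|i r IH].
  by under eq_fun do rewrite big_nil; rewrite int01_cst big_nil.
under eq_fun do rewrite big_cons; rewrite big_cons; case: (P i) => //.
by rewrite int01D ?IH//; exact: bmeas_sum.
Qed.

Lemma bounded_cvg (g_ : nat -> R -> R) g (B : R) :
  (forall n, measurable_fun setT (g_ n)) -> (forall n x, `|g_ n x| <= B) ->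
  (forall x, g_ n x @[n --> \oo] --> g x) ->
  bmeas g /\ int01 (g_ n) @[n --> \oo] --> int01 g.
Proof.
move=> mg gB gg.
have mg' : measurable_fun setT g by apply: (measurable_fun_cvg mg) => x _; exact: gg.
have ng : bmeas g.
  split=> //; exists B => x.
  have h : `|g_ n x| @[n --> \oo] --> `|g x| by apply: cvg_norm; exact: gg.
  rewrite -(cvg_lim _ h)//; apply: limr_le; first by apply/cvg_ex; eexists; exact: h.
  by apply: nearW => n /=; exact: gB.
split=> //.
have B0 : 0 <= B by rewrite (le_trans _ (gB 0%N 0)).
have [|||||_ _] := @dominated_convergence _ _ _ mu `[0%R, 1%R]%classic (measurable_itv _)
  (fun n => EFin \o g_ n) (EFin \o g) (EFin \o cst B).
- by move=> n; apply/measurable_EFinP; apply: measurable_funTS; exact: mg.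
- by apply/measurable_EFinP; exact: measurable_funTS.
- by apply: aeW => x _; apply: cvg_EFin; [exact: nearW | exact: gg].
- by apply: bmeas_integrable; exact: bmeas_cst.
- by apply: aeW => x n _; rewrite lee_fin; exact: gB.
move=> h; rewrite /int01 /Rintegral; apply: fine_cvg.
rewrite fineK; first exact: h.
by apply: integrable_fin_num => //; exact: bmeas_integrable.
Qed.

End UnitInterval.

Section DirichletIntegral.
Variables (R : realType) (p : nat).
Hypothesis pp : prime p.
Let p1 : (1 < p)%N := prime_gt1 pp.
Let p0 : (0 < p)%N := prime_gt0 pp.
Let pR0 : 0 < p%:R :> R. Proof. by rewrite ltr0n. Qed.
Local Notation mu := (@lebesgue_measure R).
Implicit Types (x y z : R).

Lemma floor_digit x a : Num.floor (x * p%:R ^+ a.+1) =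
  p%:Z * Num.floor (x * p%:R ^+ a) + (xdigit p x a)%:Z.
Proof.
set F := Num.floor (x * p%:R ^+ a.+1).
have pz : p%:Z != 0 by rewrite eqz_nat -lt0n.
have r0 : 0 <= (F %% p%:Z)%Z by rewrite modz_ge0.
have rp : (F %% p%:Z)%Z < p%:Z by rewrite ltz_pmod.
have -> : (xdigit p x a)%:Z = (F %% p%:Z)%Z by rewrite /xdigit gez0_abs.
suff -> : Num.floor (x * p%:R ^+ a) = (F %/ p%:Z)%Z by rewrite mulrC -divz_eq.
have FE := divz_eq F p%:Z.
have /andP[Fx xF] := floor_itv (x * p%:R ^+ a.+1); rewrite -/F in Fx xF.
apply: floor_def; rewrite -(ler_pM2r pR0) -(ltr_pM2r pR0) -mulrA -exprSr.
have pZ : p%:R = p%:Z%:~R :> R by [].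
apply/andP; split.
  by rewrite (le_trans _ Fx)// pZ -intrM ler_int [leRHS]FE lerDl.
rewrite (lt_le_trans xF)// pZ -intrM ler_int mulrDl mul1r.
by rewrite [in leLHS]FE -addrA lerD2l lezD1.
Qed.

Lemma measurable_xdigit a :
  measurable_fun [set: R] (fun x => (xdigit p x a)%:R : R).
Proof.
have mf b : measurable_fun [set: R] (fun x => (Num.floor (x * p%:R ^+ b))%:~R : R).
  apply: nondecreasing_measurable => // x y xy.
  by rewrite ler_int le_floor// ler_wpM2r// exprn_ge0.
rewrite (_ : (fun _ => _) = fun x => (Num.floor (x * p%:R ^+ a.+1))%:~R -
    p%:R * (Num.floor (x * p%:R ^+ a))%:~R).
  by apply: measurable_funB => //; apply: measurable_funM.
by apply/funext => x; rewrite floor_digit intrD intrM addrAC subrr add0r.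
Qed.

Lemma bmeas_dirichlet a y : bmeas (fun x => dirichlet p a x y : R).
Proof.
rewrite /dirichlet; under eq_fun do rewrite natrM.
apply: bmeasZ; elim: a => [|a IH] /=; first exact: bmeas_cst.
under eq_fun do rewrite -mulnb natrM.
apply: bmeasM => //; split; last first.
  by exists 1 => x; case: eqP => _; rewrite ?normr1 ?normr0 ?ler01.
rewrite (_ : (fun _ => _) = \1_((fun x => (xdigit p x a)%:R : R) @^-1` [set (xdigit p y a)%:R])).
  apply: measurable_indic; rewrite -[_ @^-1` _]setTI.
  by apply: measurable_xdigit => //; exact: measurable_set1.
apply/funext => x; rewrite indicE; congr (_ (nat_of_bool _)).
apply/eqP/idP => [e|]; first by rewrite inE /= e.
by rewrite inE /= => /eqP; rewrite eqr_nat => /eqP.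
Qed.

Fixpoint digits_prefix a x : nat :=
  if a is a'.+1 then (p * digits_prefix a' x + xdigit p x a')%N else 0%N.

Lemma digits_prefix_lt a x : (digits_prefix a x < p ^ a)%N.
Proof.
elim: a => [|a IH] //=; have := xdigit_lt pp x a; rewrite expnS; nia.
Qed.

Lemma agreeE a x y : agree p a x y = (digits_prefix a x == digits_prefix a y).
Proof.
elim: a => [|a IH] //=; rewrite IH; apply/andP/eqP => [[/eqP -> /eqP ->] //|e].
have xp := xdigit_lt pp x a; have yp := xdigit_lt pp y a.
have := congr1 (divn^~ p) e; have := congr1 (modn^~ p) e.
rewrite ![(p * _)%N]mulnC !modnMDl !divnMDl// !modn_small// !divn_small// !addn0.
by move=> -> ->.
Qed.

Lemma floor_prefix a x : 0 <= x < 1 -> Num.floor (x * p%:R ^+ a) = (digits_prefix a x)%:Z.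
Proof.
move=> x01; elim: a => [|a IH].
  by rewrite expr0 mulr1; apply: floor_def; rewrite x01.
by rewrite floor_digit IH /= PoszD PoszM.
Qed.

Lemma dirichlet_indic a x y : 0 <= x < 1 -> dirichlet p a x y = p%:R ^+ a *
  \1_(`[(digits_prefix a y)%:R / p%:R ^+ a, (digits_prefix a y).+1%:R / p%:R ^+ a[%classic) x.
Proof.
move=> x01; rewrite /dirichlet natrM natrX indicE agreeE; congr (_ * _%:R).
congr nat_of_bool; have pa : 0 < p%:R ^+ a :> R by rewrite exprn_gt0.
have /andP[h1 h2] := floor_itv (x * p%:R ^+ a).
rewrite floor_prefix// in h1 h2.
rewrite mem_setE in_itv/= ler_pdivrMr// ltr_pdivlMr//.
apply/eqP/andP => [<-|[l1 l2]].
  by split=> //; rewrite -natr1; move: h2; rewrite intrD.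
apply/eqP; rewrite -eqz_nat -floor_prefix//; apply/eqP; apply: floor_def.
by rewrite intrD -!pmulrn l1 natr1 l2.
Qed.

(** To share its first a digits with [y] confines a number to an interval of
    length p^-a. *)
Lemma int01_dirichlet a y : int01 (fun x => dirichlet p a x y) = 1 :> R.
Proof.
have pa : 0 < p%:R ^+ a :> R by rewrite exprn_gt0.
have iD := bmeas_integrable (bmeas_dirichlet a y).
rewrite /int01 -Rintegral_itv_bndo_bndc; last first.
  by apply: integrableS iD => //; apply: subset_itvl; rewrite bnd_simp.
pose A := `[(digits_prefix a y)%:R / p%:R ^+ a, (digits_prefix a y).+1%:R / p%:R ^+ a[%classic : set R.
have A01 : A `<=` `[0, 1[%classic.
  move=> x; rewrite /A /= !in_itv/= => /andP[Ax xA];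
  rewrite (le_trans _ Ax) ?divr_ge0 ?exprn_ge0//=.
  by rewrite (lt_le_trans xA)// ler_pdivrMr// mul1r -natrX ler_nat digits_prefix_lt.
transitivity (\int[mu]_(x in `[0, 1[) (p%:R ^+ a * \1_A x)).
  by apply: eq_Rintegral => x; rewrite inE /= in_itv /= => x01; rewrite dirichlet_indic.
rewrite /Rintegral.
under eq_integral do rewrite EFinM.
have iA : mu.-integrable `[0, 1] (EFin \o \1_A).
  apply: bmeas_integrable; split.
    by apply: measurable_indic; exact: measurable_itv.
  by exists 1 => x; rewrite indicE; case: (_ \in _); rewrite ?normr1 ?normr0.
rewrite integralZl//; last first.
  by apply: integrableS iA => //; apply: subset_itvl; rewrite bnd_simp.
rewrite integral_indic//; last exact: measurable_itv.
have muA : mu A = (p%:R ^- a)%:E.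
  rewrite /A lebesgue_measure_itv/= lte_fin ltr_pM2r ?invr_gt0// ltr_nat ltnSn.
  by rewrite -EFinB -mulrBl -natrB ?leqnSn// subSnn mul1r.
by rewrite setIidl// [X in (_ * X)%E]muA /= divff ?gt_eqF.
Qed.

Lemma agreeC a x y : agree p a x y = agree p a y x.
Proof. by rewrite !agreeE eq_sym. Qed.

Lemma agree_le a b x y : (a <= b)%N -> agree p b x y -> agree p a x y.
Proof.
move=> /subnKC <-; elim: (b - a)%N => [|n IH]; first by rewrite addn0.
by rewrite addnS /= => /andP[/IH].
Qed.

(** A number that shares its first b digits with [z] shares its first a <= b
    digits with [y] exactly when [z] does. *)
Lemma dirichletM a b x y z : (a <= b)%N ->
  dirichlet p a x y * dirichlet p b x z = dirichlet p a z y * dirichlet p b x z :> R.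
Proof.
move=> ab; rewrite {2 4}/dirichlet; case E: (agree p b x z).
  rewrite /dirichlet !agreeE.
  by have /eqP -> : digits_prefix a x == digits_prefix a z by rewrite -agreeE (agree_le ab).
by rewrite muln0 !mulr0.
Qed.

Lemma dirichletC a x y : dirichlet p a x y = dirichlet p a y x :> R.
Proof. by rewrite /dirichlet agreeC. Qed.

Lemma int01_dirichletM a b y z :
  int01 (fun x => dirichlet p a x y * dirichlet p b x z) =
  dirichlet p (minn a b) y z :> R.
Proof.
wlog ab : a b y z / (a <= b)%N => [hw|].
  case/orP: (leq_total a b) => [ab|ba]; first exact: hw.
  by under eq_fun do rewrite mulrC; rewrite (hw b a z y ba) dirichletC minnC.
under eq_fun do rewrite dirichletM//.
rewrite int01Z; last exact: bmeas_dirichlet.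
by rewrite int01_dirichlet mulr1 (minn_idPl ab) dirichletC.
Qed.

End DirichletIntegral.

Section KernelIntegral.
Variables (R : realType) (p : nat).
Hypothesis pp : prime p.
Let p1 : (1 < p)%N := prime_gt1 pp.
Let p0 : (0 < p)%N := prime_gt0 pp.
Let pR0 : 0 < p%:R :> R. Proof. by rewrite ltr0n. Qed.
Variables (c q : R).
Hypotheses (c0 : 0 < c) (q0 : 0 < q) (pq : p%:R * q < 1).
Implicit Types (x y z : R).
Local Notation ps := (fun n x y => series (kterm p c q x y) n).
Local Notation ker := (kernel1 p c q).

Lemma bmeas_kterm a y : bmeas (fun x => kterm p c q x y a).
Proof. by apply: bmeasZ; apply: bmeasB; exact: bmeas_dirichlet. Qed.

Lemma bmeas_ps n y : bmeas (fun x => ps n x y).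
Proof. by apply: bmeas_sum => a; exact: bmeas_kterm. Qed.

Lemma ps_bounded n x y : `|ps n x y| <= c * p%:R / (1 - p%:R * q).
Proof.
apply: (le_trans (ler_norm_sum _ _ _)).
have pq0 : 0 < p%:R * q by rewrite mulr_gt0.
apply: le_trans (geometric_le_lim n _ pq0 _).
- by apply: ler_sum => a _; apply: kterm_le => //; exact: ltW.
- by rewrite mulr_ge0// ltW.
- by rewrite ger0_norm// ltW.
Qed.

Lemma ps_cvg x y : ps n x y @[n --> \oo] --> ker x y.
Proof. by apply: kernel1_cvg => //; exact: ltW. Qed.

Lemma kernel1_bounded_cvg y : bmeas (fun x => ker x y) /\
  int01 (fun x => ps n x y) @[n --> \oo] --> int01 (fun x => ker x y).
Proof.
apply: (bounded_cvg (B := c * p%:R / (1 - p%:R * q))) => [n|n x|x].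
- by have [] := bmeas_ps n y.
- exact: ps_bounded.
- exact: ps_cvg.
Qed.

Lemma bmeas_kernel1 y : bmeas (fun x => ker x y).
Proof. by have [] := kernel1_bounded_cvg y. Qed.

Lemma int01_kernel1 y : int01 (fun x => ker x y) = 0.
Proof.
have [_ h] := kernel1_bounded_cvg y.
have e n : int01 (fun x => ps n x y) = 0.
  rewrite /series /= int01_sum; last by move=> a; exact: bmeas_kterm.
  apply: big1 => a _; rewrite /kterm int01Z; last first.
    by apply: bmeasB; exact: bmeas_dirichlet.
  by rewrite int01B ?int01_dirichlet ?subrr ?mulr0//; exact: bmeas_dirichlet.
rewrite -(cvg_lim _ h)//; under eq_fun do rewrite e.
exact: lim_cst.
Qed.

(** The terms of the series are orthogonal. *)
Lemma int01_ktermM a b y z :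
  int01 (fun x => kterm p c q x y a * kterm p c q x z b) =
  if a == b then kterm p (c ^+ 2) (q ^+ 2) y z a else 0.
Proof.
have nD a' y' : bmeas (fun x => dirichlet p a' x y' : R) by exact: bmeas_dirichlet.
have nM a' b' : bmeas (fun x => dirichlet p a' x y * dirichlet p b' x z : R).
  exact: bmeasM.
rewrite (_ : (fun _ => _) = fun x => (c * q ^+ a) * (c * q ^+ b) *
  ((dirichlet p a.+1 x y * dirichlet p b.+1 x z - dirichlet p a.+1 x y * dirichlet p b x z)
   - (dirichlet p a x y * dirichlet p b.+1 x z - dirichlet p a x y * dirichlet p b x z))); last first.
  by apply/funext => x; rewrite /kterm; ring.
rewrite int01Z; last by do !apply: bmeasB.
rewrite !int01B//; try by do ?apply: bmeasB.
rewrite !int01_dirichletM//.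
have [<-|ab] := eqVneq a b.
  rewrite !minnn (minn_idPr (leqnSn a)) (minn_idPl (leqnSn a)) /kterm subrr subr0.
  by rewrite -!exprM mulnC exprM; ring.
have [lt|lt|e] := ltngtP a b; last by rewrite e eqxx in ab.
  by rewrite !(minn_idPl _) ?subrr ?mulr0//; lia.
by rewrite !(minn_idPr _) ?subrr ?mulr0//; lia.
Qed.

(** Integration against the kernel squares its Walsh coefficients. *)
Lemma int01_kernel1M y z :
  int01 (fun x => ker x y * ker x z) = kernel1 p (c ^+ 2) (q ^+ 2) y z.
Proof.
pose B := c * p%:R / (1 - p%:R * q).
have h : int01 (fun x => ps n x y * ps n x z) @[n --> \oo] -->
    int01 (fun x => ker x y * ker x z).
  apply: (bounded_cvg (B := B * B) _ _ _).2 => [n|n x|x].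
  - by have [] := bmeasM (bmeas_ps n y) (bmeas_ps n z).
  - by rewrite normrM ler_pM// ps_bounded.
  - by apply: cvgM; exact: ps_cvg.
have e n : int01 (fun x => ps n x y * ps n x z) =
    series (kterm p (c ^+ 2) (q ^+ 2) y z) n.
  rewrite /series /= !big_mkord.
  under eq_fun do rewrite !big_mkord big_distrlr /=.
  rewrite int01_sum => [|a]; last first.
    by apply: bmeas_sum => b; apply: bmeasM; exact: bmeas_kterm.
  apply: eq_bigr => a _; rewrite int01_sum => [|b]; last first.
    by apply: bmeasM; exact: bmeas_kterm.
  under eq_bigr do rewrite int01_ktermM.
  by rewrite -big_mkcond (big_pred1 a)// => b; rewrite /= eq_sym.
rewrite -(cvg_lim _ h)//; under eq_fun do rewrite e.
by [].
Qed.

End KernelIntegral.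

(** * Integration over the unit cube *)

Section TupleIntegral.
Variable (R : realType).
Local Notation mu := (@lebesgue_measure R).
Local Notation T := (measurableTypeR R).

Definition centered_cube n (k : nat) : set (n.-tuple T) :=
  [set z | forall i, `|tnth z i| <= k%:R].
Arguments centered_cube : clear implicits.

Lemma measurable_centered_cube n k : measurable (centered_cube n k).
Proof.
rewrite (_ : centered_cube n k = \bigcap_(i in [set: 'I_n])
    ((@tnth n T ^~ i) @^-1` `[- k%:R, k%:R]%classic)).
  apply: fin_bigcap_measurable => // i _.
  by rewrite -[_ @^-1` _]setTI; apply: measurable_tnth => //; exact: measurable_itv.
apply/seteqP; split=> z h i; first by move=> _; rewrite /= in_itv /= -ler_norml.
by have := h i I; rewrite /= in_itv /= -ler_norml.
Qed.

Lemma centered_cube_fin n k : (lebesgue_tuple R n (centered_cube n k) < +oo)%E.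
Proof.
elim: n => [|n IH]; first by rewrite /= diracE ltry.
rewrite /= /measure_tcons /pushforward.
rewrite (_ : _ @^-1` _ = centered_cube n k `*` `[- k%:R, k%:R]%classic).
  rewrite product_measure1E; [|exact: measurable_centered_cube|exact: measurable_itv].
  rewrite lte_mul_pinfty// ?ge0_fin_numE//.
  rewrite [X in (X < _)%E]lebesgue_measure_itv /=.
  by case: ifP => _; rewrite -?EFinB ?ltry.
apply/seteqP; split=> [[z x] h|[z x] [/= h x1] i].
  split=> [i|]; first by have := h (lift ord0 i); rewrite tnthS.
  by have := h ord0; rewrite /= in_itv/= -ler_norml.
case: (unliftP ord0 i) => [j|] -> ; first by rewrite tnthS; exact: h.
by move: x1; rewrite /= in_itv /= -ler_norml.
Qed.

(** A name to which the sigma-finite structure required by Fubini's theorem can be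
    attached. *)
Definition ltuple n : set (n.-tuple T) -> \bar R := lebesgue_tuple R n.
Arguments ltuple : clear implicits.

Lemma sigma_finite_ltuple n : sigma_finite [set: n.-tuple T] (ltuple n).
Proof.
exists (centered_cube n) => [|k]; last by split; [exact: measurable_centered_cube | exact: centered_cube_fin].
apply/seteqP; split=> // z _.
have [k kz] : exists k : nat, forall i, `|tnth z i| <= k%:R.
  exists (\max_(i < n) Num.truncn (`|tnth z i|)).+1 => i.
  rewrite (le_trans (ltW (truncnS_gt _)))// ler_nat ltnS.
  exact: (leq_bigmax_cond (F := fun i => Num.truncn `|tnth z i|)).
by exists k.
Qed.

HB.instance Definition _ n := Measure.copy (ltuple n) (lebesgue_tuple R n).
HB.instance Definition _ n :=
  Measure_isSigmaFinite.Build _ _ _ (ltuple n) (sigma_finite_ltuple n).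

Lemma measurable_tuple_prod n (h : nat -> T -> R) :
  (forall i, measurable_fun setT (h i)) ->
  measurable_fun [set: n.-tuple T] (fun z : n.-tuple T => \prod_(i < n) h i z`_i).
Proof.
move=> mh; apply: measurable_prod => i _.
rewrite (_ : (fun _ => _) = h i \o (@tnth n T ^~ i)).
  by apply: measurableT_comp; [exact: mh | exact: measurable_tnth].
by apply/funext => z /=; rewrite (tnth_nth 0).
Qed.

(** Fubini, one coordinate at a time. *)
Lemma integral_tuple_prod n (h : nat -> T -> R) :
  (forall i, mu.-integrable setT (EFin \o h i)) ->
  (lebesgue_tuple R n).-integrable setT
    (fun z : n.-tuple T => (\prod_(i < n) h i z`_i)%:E) /\
  (\int[lebesgue_tuple R n]_z (\prod_(i < n) h i z`_i)%:E =
    (\prod_(i < n) \int[mu]_x h i x)%:E)%E.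
Proof.
elim: n h => [|n IH] h ih.
  split.
    under eq_fun do rewrite big_ord0.
    apply/integrableP; split; first exact: measurable_cst.
    by rewrite integral_dirac//= diracT mul1e ltry.
  rewrite integral_dirac//=; last by under eq_fun do rewrite big_ord0; exact: measurable_cst.
  by rewrite diracT mul1e !big_ord0.
have mh i : measurable_fun setT (h i).
  by apply/measurable_EFinP; exact: measurable_int (ih i).
have [iP IP] := IH (fun i => h i.+1) (fun i => ih i.+1).
pose P (z : n.-tuple T) := \prod_(i < n) h i.+1 z`_i.
have mP : measurable_fun setT P by exact: (measurable_tuple_prod (h := fun i => h i.+1)).
pose f (zx : n.-tuple T * T) : \bar R := (P zx.1 * h 0%N zx.2)%:E.
have mf : measurable_fun setT f.
  apply/measurable_EFinP; apply: measurable_funM.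
    exact: (measurableT_comp mP measurable_fst).
  exact: (measurableT_comp (mh 0%N) measurable_snd).
have fE : (fun z : n.+1.-tuple T => (\prod_(i < n.+1) h i z`_i)%:E) \o @tcons R n = f.
  apply/funext => -[z x] /=; rewrite big_ord_recl /= mulrC.
  by rewrite /f /P; congr (_ * _)%:E; apply: eq_bigr.
have i_f : (ltuple n \x mu)%E.-integrable setT f.
  apply/(integrable12ltyP (ltuple n) mu mf).
  have /integrableP[_ P1] := iP; have /integrableP[_ H1] := ih 0%N.
  under eq_integral => z _.
    under eq_integral => x _ do rewrite /f /= normrM EFinM.
    rewrite ge0_integralZl//; last first.
      by apply/measurable_EFinP; exact: measurableT_comp.
    over.
  rewrite ge0_integralZr//.
  - by rewrite lte_mul_pinfty// ?integral_ge0// ge0_fin_numE ?integral_ge0.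
  - by apply/measurable_EFinP; exact: measurableT_comp.
  - exact: integral_ge0.
have mF : measurable_fun setT (fun z : n.+1.-tuple T => (\prod_(i < n.+1) h i z`_i)%:E).
  by apply/measurable_EFinP; exact: measurable_tuple_prod.
split.
  by apply: (integrable_pushforward (@measurable_tcons R n)) => //; rewrite fE.
transitivity (\int[(ltuple n \x mu)%E]_z f z)%E.
  rewrite -fE [LHS](integral_pushforward (@measurable_tcons R n))//.
  by rewrite fE.
rewrite -(integral12_prod_meas1 i_f) /fubini_F.
under eq_integral => z _.
  under eq_integral => x _ do rewrite /f /= EFinM.
  rewrite integralZl//=; last exact: (ih 0%N).
  over.
transitivity ((\int[lebesgue_tuple R n]_z (P z)%:E) * (\int[mu]_x (h 0%N x)%:E))%E.
  have /fineK <- : (\int[mu]_x (h 0%N x)%:E)%E \is a fin_num by exact: integrable_fin_num (ih 0%N).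
  by rewrite -integralZr//; exact: (ih 0%N).
rewrite IP big_ord_recl mulrC EFinM; congr (_ * _)%E.
by rewrite /Rintegral fineK//; exact: integrable_fin_num (ih 0%N).
Qed.

End TupleIntegral.

Section CubeIntegral.
Variable (R : realType).
Local Notation mu := (@lebesgue_measure R).
Local Notation T := (measurableTypeR R).

Lemma measurable_unit_cube n : measurable (unit_cube (R := R) (n := n)).
Proof.
rewrite (_ : unit_cube (n := n) = \bigcap_(i in [set: 'I_n])
    ((@tnth n T ^~ i) @^-1` `[0, 1]%classic)).
  apply: fin_bigcap_measurable => // i _.
  by rewrite -[_ @^-1` _]setTI; apply: measurable_tnth => //; exact: measurable_itv.
apply/seteqP; split=> z h i; first by move=> _; rewrite /= in_itv /=; exact: h.
by have := h i I; rewrite /= in_itv.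
Qed.

(** Cutting each factor off outside [0, 1] turns the integral over the cube into
    one over the whole space. *)
Lemma int_cube_prod n (h : 'I_n -> R -> R) : (forall i, bmeas (h i)) ->
  (lebesgue_tuple R n).-integrable (unit_cube (n := n))
    (fun z : n.-tuple T => (\prod_(i < n) h i z`_i)%:E) /\
  \int[lebesgue_tuple R n]_(z in unit_cube (n := n)) \prod_(i < n) h i z`_i =
  \prod_(i < n) int01 (h i).
Proof.
move=> nh.
pose k (i : nat) : R -> R :=
  if insub i is Some i' then h i' \_ `[0, 1] else cst 0.
have kE (i : 'I_n) : k i = h i \_ `[0, 1] by rewrite /k valK.
have ik i : mu.-integrable setT (EFin \o k i).
  rewrite /k; case: insubP => [i' _ _|_]; last exact: integrable0.
  have := bmeas_integrable (nh i'); rewrite integrable_mkcond//.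
  by congr (mu.-integrable _ _); apply/funext => x; rewrite /= !patchE; case: ifP.
have [iF IF] := integral_tuple_prod n ik.
have FE : (fun z : n.-tuple T => (\prod_(i < n) k i z`_i)%:E) =
    (fun z : n.-tuple T => (\prod_(i < n) h i z`_i)%:E) \_ (unit_cube (n := n)).
  apply/funext => z; rewrite patchE; case: ifPn => [|/negP zc].
    rewrite inE => zc; congr _%:E; apply: eq_bigr => i _.
    rewrite kE patchE ifT// inE /= in_itv /=; have := zc i.
    by rewrite (tnth_nth 0).
  have [i zi] : exists i : 'I_n, ~~ (0 <= z`_i <= 1).
    apply/existsP; rewrite -negb_forall; apply/negP => /forallP h1; apply: zc.
    by rewrite inE => i; rewrite (tnth_nth 0); exact: h1.
  rewrite (bigD1 i)//= kE patchE ifF ?mul0r//.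
  by apply/negbTE/negP; rewrite inE /= in_itv /=; exact/negP.
split.
  by apply/(integrable_mkcond _ (@measurable_unit_cube n)); rewrite -FE.
rewrite /Rintegral integral_mkcond.
under eq_integral do rewrite -FE.
rewrite IF /=; apply: eq_bigr => i _; rewrite /int01 Rintegral_mkcond.
by rewrite kE.
Qed.

Lemma int_cube_sum n (N : finType) (F : N -> n.-tuple T -> R) :
  (forall i, (lebesgue_tuple R n).-integrable (unit_cube (n := n)) (EFin \o F i)) ->
  \int[lebesgue_tuple R n]_(z in unit_cube (n := n)) \sum_i F i z =
  \sum_i \int[lebesgue_tuple R n]_(z in unit_cube (n := n)) F i z.
Proof.
move=> iF; have mc := @measurable_unit_cube n.
elim: (index_enum N) => [|i r IH].
  rewrite big_nil -[RHS](mul0r (fine (lebesgue_tuple R n (unit_cube (n := n))))).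
  by rewrite -Rintegral_cst//; apply: eq_Rintegral => z _; rewrite big_nil.
rewrite big_cons -IH -RintegralD//.
  by apply: eq_Rintegral => z _; rewrite big_cons.
rewrite (_ : EFin \o _ = fun z => (\sum_(i <- r) (EFin \o F i) z)%E).
  by apply: integrable_sum.
by apply/funext => z; rewrite /= sumEFin.
Qed.

Variable (s : nat).

(** Sums of products of univariate functions are stable under integration over
    some of the variables, so that they contain all the ANOVA effects. *)
Lemma int_over_tensor (w : {set 'I_s}) (N : finType) (a : N -> R)
    (g : N -> 'I_s -> R -> R) (x : 'I_s -> R) :
  (forall n j, bmeas (g n j)) ->
  int_over w (fun x => \sum_n a n * \prod_j g n j (x j)) x =
  \sum_n a n * \prod_j (if j \in w then int01 (g n j) else g n j (x j)).
Proof.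
move=> ng; rewrite /int_over.
pose b n := a n * \prod_(j | j \notin w) g n j (x j).
have E n (z : (#|w|).-tuple T) : a n * \prod_j g n j (subst_on w x z j) =
    b n * \prod_(i < #|w|) g n (enum_val i) z`_i.
  rewrite (bigID (mem w))/= mulrCA mulrC /b; congr (_ * _ * _).
    by apply: eq_bigr => j jw; rewrite /subst_on (negbTE jw).
  rewrite big_enum_val; apply: eq_bigr => i _.
  rewrite /subst_on enum_valP (enum_val_nth (enum_val i)) index_uniq ?enum_uniq//.
  by rewrite -cardE.
transitivity (\int[lebesgue_tuple R #|w|]_(z in unit_cube (n := #|w|))
    \sum_n b n * \prod_(i < #|w|) g n (enum_val i) z`_i).
  by apply: eq_Rintegral => z _; apply: eq_bigr => n _; rewrite E.
have H n := int_cube_prod (h := fun i : 'I_(#|w|) => g n (enum_val i))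
  (fun i => ng n (enum_val i)).
rewrite int_cube_sum => [|n]; last first.
  have [ii _] := H n; rewrite (_ : EFin \o _ =
    fun z : (#|w|).-tuple T => ((b n)%:E * (\prod_(i < #|w|) g n (enum_val i) z`_i)%:E)%E).
    by apply: integrableZl => //; exact: measurable_unit_cube.
  by apply/funext => z; rewrite /= EFinM.
apply: eq_bigr => n _; have [ii IE] := H n.
rewrite RintegralZl//; last exact: measurable_unit_cube.
rewrite IE.
rewrite (bigID (mem w) predT) /= /b -mulrA [X in _ = _ * X]mulrC.
congr (_ * (_ * _)); first by apply: eq_bigr => j /negbTE ->.
rewrite -(big_enum_val (fun j => int01 (g n j))) /=.
by apply: eq_bigr => j ->.
Qed.

End CubeIntegral.

(** * ANOVA effects of product functions *)

Lemma prodD1_subsets (R : comNzRingType) (I : finType) (u : {set I}) (F : I -> R) :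
  \prod_(j in u) (1 + F j) = \sum_(v : {set I} | v \subset u) \prod_(j in v) F j.
Proof.
rewrite big_mkcond /=.
under eq_bigr => j _.
  rewrite (_ : (if _ then _ else _) = (if j \in u then F j else 0) + 1); last first.
    by case: ifP; rewrite ?add0r// addrC.
  over.
rewrite bigA_distr /= [RHS]big_mkcond; apply: eq_bigr => v _.
case: ifPn => [vu|/subsetPn[j jv ju]].
  by rewrite [RHS]big_mkcond; apply: eq_bigr => j _; case: ifP => // /(fintype.subsetP vu) ->.
by rewrite (bigD1 j)//= jv (negbTE ju) mul0r.
Qed.

Section AnovaProduct.
Variables (R : realType) (s : nat) (N : finType).
Variables (a : N -> R) (k : N -> 'I_s -> R -> R).
Hypothesis nk : forall n j, bmeas (k n j).
Hypothesis k0 : forall n j, int01 (k n j) = 0.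

Let g (x : 'I_s -> R) : R := \sum_n a n * \prod_j (1 + k n j (x j)).

Lemma int01_1D n j : int01 (fun y => 1 + k n j y) = 1.
Proof. by rewrite int01D ?int01_cst ?k0 ?addr0//; exact: bmeas_cst. Qed.

(** Integrating out a variable replaces its factor by 1, so that the expansion
    of the product into subsets is the ANOVA decomposition. *)
Lemma anova_product (u : {set 'I_s}) (x : 'I_s -> R) :
  anova g u x = \sum_n a n * \prod_(j in u) k n j (x j).
Proof.
have [c] := ubnP #|u|; elim: c => // c IH in u *; rewrite ltnS => uc.
rewrite anovaE /g (int_over_tensor _ _ (g := fun n j y => 1 + k n j y)); last first.
  by move=> n j; apply: bmeasD => //; exact: bmeas_cst.
have -> : \sum_n a n * \prod_j (if j \in ~: u then int01 (fun y => 1 + k n j y)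
      else 1 + k n j (x j)) =
    \sum_(v : {set 'I_s} | v \subset u) \sum_n a n * \prod_(j in v) k n j (x j).
  rewrite exchange_big /=; apply: eq_bigr => n _.
  rewrite -mulr_sumr -(prodD1_subsets _ (fun j => k n j (x j))); congr (_ * _).
  rewrite [RHS]big_mkcond; apply: eq_bigr => j _.
  by rewrite finset.in_setC int01_1D; case: (j \in u).
rewrite (bigD1 u)//= -addrA -[RHS]addr0; congr (_ + _).
apply/eqP; rewrite subr_eq0; apply/eqP; apply: eq_big => v.
  by rewrite finset.properEneq andbC.
rewrite andbC -finset.properEneq => vu; rewrite IH//.
exact: leq_trans (proper_card vu) uc.
Qed.

(** The effect for [u] has mean 0 because each of its factors has. *)
Lemma variance_product (u : {set 'I_s}) : u != finset.set0 ->
  effect_variance g u = \sum_n \sum_n' a n * a n' *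
    \prod_(j in u) int01 (fun y => k n j y * k n' j y).
Proof.
move=> /set0Pn[j0 j0u]; rewrite /effect_variance.
pose h n j : R -> R := if j \in u then k n j else cst 1.
have nh n j : bmeas (h n j) by rewrite /h; case: ifP => // _; exact: bmeas_cst.
have aE : anova g u = fun x => \sum_n a n * \prod_j h n j (x j).
  apply/funext => x; rewrite anova_product; apply: eq_bigr => n _; congr (_ * _).
  by rewrite big_mkcond; apply: eq_bigr => j _; rewrite /h; case: ifP.
have -> : int_over u (anova g u) (fun=> 0) = 0.
  rewrite aE int_over_tensor//; apply: big1 => n _.
  by rewrite (bigD1 j0)//= j0u /h j0u k0 mul0r mulr0.
rewrite aE.
have -> : (fun x => (\sum_n a n * \prod_j h n j (x j) - 0) ^+ 2) =
    fun x : 'I_s -> R => \sum_(t : N * N) a t.1 * a t.2 *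
      \prod_j (h t.1 j (x j) * h t.2 j (x j)).
  apply/funext => x; rewrite subr0 expr2 big_distrlr /= pair_big /=.
  by apply: eq_bigr => -[n n'] _ /=; rewrite big_split /= mulrACA.
rewrite (int_over_tensor _ (fun t : N * N => a t.1 * a t.2)
  (g := fun t j y => h t.1 j y * h t.2 j y)) => [|t j]; last exact: bmeasM.
rewrite pair_big /=; apply: eq_bigr => -[n n'] _ /=; congr (_ * _).
by rewrite [RHS]big_mkcond; apply: eq_bigr => j _; rewrite /h; case: (j \in u) => //=; rewrite mulr1.
Qed.

End AnovaProduct.

(** * Fourier analysis of column vectors *)

Section Characters.
Variables (R : realType) (p : nat).
Hypothesis pp : prime p.
Let p1 : (1 < p)%N := prime_gt1 pp.
Let p0 : (0 < p)%N := prime_gt0 pp.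

Lemma omega_expE (n : nat) : omega R p ^+ n = omega R p ^+ (n%:R : 'F_p).
Proof. by rewrite val_Fp_nat// expr_mod// omega_p. Qed.

Variable m : nat.
Local Notation vec := 'cV['F_p]_m.
Implicit Types (h v : vec).

Definition dot h v : 'F_p := \sum_i h i 0 * v i 0.

(** The characters of the additive group of column vectors, indexed by the
    vectors themselves. *)
Definition chr h v : R[i] := omega R p ^+ dot h v.

Lemma dotC h v : dot h v = dot v h.
Proof. by apply: eq_bigr => i _; rewrite mulrC. Qed.

Lemma dotD h v v' : dot h (v + v') = dot h v + dot h v'.
Proof. by rewrite -big_split; apply: eq_bigr => i _; rewrite mxE mulrDr. Qed.

Lemma dot_trmx (A : 'M['F_p]_m) h v : dot h (A *m v) = dot (A^T *m h) v.
Proof.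
rewrite /dot; under eq_bigr do rewrite mxE mulr_sumr.
rewrite exchange_big /=; apply: eq_bigr => i _; rewrite mxE mulr_suml.
by apply: eq_bigr => j _; rewrite mxE mulrCA mulrA.
Qed.

Lemma omega_D (a b : 'F_p) :
  omega R p ^+ (a + b)%R = omega R p ^+ a * omega R p ^+ b.
Proof. by rewrite -exprD [RHS]omega_expE natrD !natr_Zp. Qed.

Lemma chrC h v : chr h v = chr v h.
Proof. by rewrite /chr dotC. Qed.

Lemma chrDr h v v' : chr h (v + v') = chr h v * chr h v'.
Proof. by rewrite /chr dotD omega_D. Qed.

Lemma chrDl h h' v : chr (h + h') v = chr h v * chr h' v.
Proof. by rewrite ![chr _ v]chrC chrDr. Qed.

Lemma chr0 h : chr h 0 = 1.
Proof. by rewrite /chr /dot big1 ?expr0// => i _; rewrite mxE mulr0. Qed.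

Lemma chr0l v : chr 0 v = 1.
Proof. by rewrite chrC chr0. Qed.

Lemma chr_suml (I : finType) (F : I -> vec) v :
  chr (\sum_i F i) v = \prod_i chr (F i) v.
Proof.
elim/big_rec2: _ => [|i x y _ <-]; first by rewrite chr0l.
by rewrite chrDl.
Qed.

Lemma chrNr h v : chr h (- v) = Num.conj (chr h v).
Proof.
have c0 : chr h v != 0 by rewrite expf_neq0 ?omega_neq0.
apply: (mulfI c0); rewrite -chrDr subrr chr0 -normCK.
by rewrite /chr normrX norm_omega !expr1n.
Qed.

Lemma chrNl h v : chr (- h) v = Num.conj (chr h v).
Proof. by rewrite chrC chrNr chrC. Qed.

Lemma chr_trmx (A : 'M['F_p]_m) h v : chr h (A *m v) = chr (A^T *m h) v.
Proof. by rewrite /chr dot_trmx. Qed.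

Lemma sum_chr h : \sum_v chr h v = (p ^ m)%:R *+ (h == 0).
Proof.
have [->|h0] := eqVneq h 0.
  under eq_bigr do rewrite chr0l.
  by rewrite sumr_const card_mx card_Fp// muln1.
have [i hi] : exists i, h i 0 != 0.
  apply/existsP; rewrite -negb_forall; apply: contra h0 => /forallP z.
  by apply/eqP/matrixP => i j; rewrite ord1 mxE; apply/eqP.
pose v0 : vec := delta_mx i 0.
have c1 : chr h v0 != 1.
  rewrite /chr -(prim_order_dvd (omega_prim R pp)).
  rewrite (_ : dot h v0 = h i 0); last first.
    rewrite /dot (bigD1 i)//= mxE !eqxx mulr1 big1 ?addr0// => j ji.
    by rewrite mxE (negbTE ji) mulr0.
  by apply: contra hi; rewrite /dvdn modn_small ?Fp_lt// -val_eqE.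
have /eqP : (chr h v0 - 1) * \sum_v chr h v = 0.
  rewrite mulrBl mul1r mulr_sumr; apply/eqP; rewrite subr_eq0; apply/eqP.
  rewrite [RHS](reindex_inj (addrI v0)) /=.
  by apply: eq_bigr => v _; rewrite chrDr.
by rewrite mulf_eq0 subr_eq0 (negbTE c1) => /eqP.
Qed.

Definition trans (F : vec -> R[i]) h : R[i] := \sum_v F v * chr h v.

Lemma trans_chr (I : finType) (b : I -> R[i]) (k : I -> vec) h :
  trans (fun v => \sum_i b i * chr (k i) v) h =
  (p ^ m)%:R * \sum_(i | k i == - h) b i.
Proof.
rewrite /trans; under eq_bigr do rewrite mulr_suml.
rewrite exchange_big /= mulr_sumr [RHS]big_mkcond; apply: eq_bigr => i _.
under eq_bigr do rewrite -mulrA -chrDl.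
rewrite -mulr_sumr sum_chr addr_eq0; case: eqP => _; last by rewrite mulr0.
by rewrite mulrC.
Qed.

Lemma trans_conv (c F : vec -> R[i]) h :
  trans (fun v => \sum_v' c v' * F (v - v')) h = trans c h * trans F h.
Proof.
rewrite /trans mulr_suml; under eq_bigr do rewrite mulr_suml.
rewrite exchange_big /=; apply: eq_bigr => v' _.
rewrite (reindex_inj (addIr v')) /= mulr_sumr; apply: eq_bigr => v _.
by rewrite addrK chrDr; ring.
Qed.

Lemma plancherel (F G : vec -> R[i]) :
  (p ^ m)%:R * \sum_v F v * G v = \sum_h trans F (- h) * trans G h.
Proof.
rewrite /trans; under [RHS]eq_bigr do rewrite big_distrlr /=.
rewrite exchange_big /= mulr_sumr; apply: eq_bigr => v _.
rewrite exchange_big /= (bigD1 v)//= [X in _ = _ + X]big1 => [|w wv].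
  rewrite addr0; under eq_bigr => h _.
    rewrite mulrACA -chrDl addNr chr0l mulr1.
    over.
  by rewrite sumr_const card_mx card_Fp// muln1 mulr_natl.
under eq_bigr => h _.
  rewrite mulrACA chrNl -chrNr -chrDr addrC chrC.
  over.
by rewrite -mulr_sumr sum_chr subr_eq0 (negbTE wv) mulr0.
Qed.

Lemma plancherel_conv (c F : vec -> R[i]) :
  (p ^ m)%:R * \sum_v \sum_v' c v * c v' * F (v - v') =
  \sum_h trans c (- h) * (trans c h * trans F h).
Proof.
under [RHS]eq_bigr do rewrite -trans_conv.
rewrite -plancherel; congr (_ * _); apply: eq_bigr => v _.
by rewrite mulr_sumr; apply: eq_bigr => v' _; rewrite mulrA.
Qed.

End Characters.

(** * Cosets and characters on the net *)

Section MinimalElements.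
Variable s : nat.
Implicit Types (k l : {ffun 'I_s -> nat}).

(** Minimizes one coordinate after the other. *)
Lemma lex_min (P : set {ffun 'I_s -> nat}) : P !=set0 ->
  exists2 k, P k & forall l, P l -> lexle k l.
Proof.
move=> P0.
suff main t : (t <= s)%N -> exists2 k, P k & forall l, P l ->
    (forall i : 'I_s, (i < t)%N -> k i = l i) \/
    exists j : 'I_s, [/\ (j < t)%N,
      forall i : 'I_s, (i < j)%N -> k i = l i & (k j < l j)%N].
  have [k Pk kmin] := main s (leqnn s).
  exists k => // l /kmin[kl|[j [_ kl klj]]]; last by right; exists j.
  by left; apply/ffunP => i; exact: kl.
elim: t => [|t IH] ts.
  by have [k Pk] := P0; exists k => // l _; left.
have [k Pk kmin] := IH (ltnW ts).
pose jt : 'I_s := Ordinal ts.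
pose Q v := `[< exists2 l, P l & (forall i : 'I_s, (i < t)%N -> k i = l i) /\ l jt = v >].
have exQ : exists v, Q v by exists (k jt); apply/asboolP; exists k.
case: (ex_minnP exQ) => v /asboolP[l Pl [kl lv]] vmin.
exists l => // l' Pl'.
have [kl'|[j [jt' kl' klj]]] := kmin l' Pl'; last first.
  right; exists j; split; first exact: ltnW.
    by move=> i ij; rewrite -kl ?kl'// (ltn_trans ij).
  by rewrite -kl.
have : (l jt <= l' jt)%N by rewrite lv; apply: vmin; apply/asboolP; exists l'.
rewrite leq_eqVlt => /predU1P[e|lt]; [left=> i|right; exists jt; split=> //].
  rewrite ltnS leq_eqVlt => /predU1P[it|it]; last by rewrite -kl ?kl'.
  by have -> : i = jt by exact: val_inj.
by move=> i it; rewrite -kl ?kl'.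
Qed.

Lemma lexle_anti k l : lexle k l -> lexle l k -> k = l.
Proof.
move=> [//|[j kl klj]] [//|[j' lk lkj]].
have [jj|jj|/val_inj jj] := ltngtP j j'.
- by move: klj; rewrite lk// ltnn.
- by move: lkj; rewrite kl// ltnn.
- by move: klj; rewrite jj ltnNge ltnW.
Qed.

(** Each coset has exactly one least element for [nu] refined by the
    lexicographic order. *)
Lemma Kset_bij p m (C : 'I_s -> 'M['F_p]_m) :
  (forall h, Dset C h !=set0) ->
  set_bij (Kset C) [set: 'cV['F_p]_m] (cdot C).
Proof.
move=> D0; split=> //.
- move=> k l; rewrite !inE => Kk Kl kl.
  have [lt|[e kle]] := Kk l (esym kl); have [lt'|[e' lek]] := Kl k kl.
  + by move: (ltn_trans lt lt'); rewrite ltnn.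
  + by rewrite e' ltnn in lt.
  + by rewrite e ltnn in lt'.
  + exact: lexle_anti.
- move=> h _.
  pose Q v := `[< exists2 l, Dset C h l & nu p l = v >].
  have exQ : exists v, Q v.
    by have [l Dl] := D0 h; exists (nu p l); apply/asboolP; exists l.
  case: (ex_minnP exQ) => v /asboolP[l0 Dl0 lv] vmin.
  have [k [Dk kv] kmin] := @lex_min [set l | Dset C h l /\ nu p l = v]
    (ex_intro _ l0 (conj Dl0 lv)).
  exists k => // l; rewrite Dk => Dl.
  have : (v <= nu p l)%N by apply: vmin; apply/asboolP; exists l.
  rewrite kv leq_eqVlt => /predU1P[e|]; last by left.
  by right; split=> //; exact: kmin.
Qed.

End MinimalElements.

Section NetCharacters.
Variables (R : realType) (p : nat).
Hypothesis pp : prime p.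
Let p1 : (1 < p)%N := prime_gt1 pp.
Let p0 : (0 < p)%N := prime_gt0 pp.

Lemma digit_lt k i : (digit p k i < p)%N.
Proof. by rewrite /digit ltn_mod. Qed.

Lemma digit_inj m n n' : (n < p ^ m)%N -> (n' < p ^ m)%N ->
  (forall i, (i < m)%N -> digit p n i = digit p n' i) -> n = n'.
Proof.
have pm0 k : (0 < p ^ k)%N by rewrite expn_gt0 p0.
elim: m n n' => [|m IH] n n'; first by rewrite !ltnS !leqn0 => /eqP -> /eqP ->.
rewrite expnS => nm nm' d; rewrite (divn_eq n (p ^ m)) (divn_eq n' (p ^ m)).
have top k : (k < p * p ^ m)%N -> (k %/ p ^ m)%N = digit p k m.
  by move=> km; rewrite /digit modn_small// ltn_divLR.
rewrite !top// d//; congr (_ + _)%N; apply: IH; rewrite ?ltn_mod// => i im.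
have := d i (ltnW im).
rewrite {1}(divn_eq n (p ^ m)) {1}(divn_eq n' (p ^ m)).
by rewrite addnC mulnC [X in _ = digit p X i]addnC [(n' %/ _ * _)%N]mulnC !digit_low.
Qed.

Lemma dvec_modn m k : dvec p m (k %% p ^ m) = dvec p m k.
Proof.
apply/colP => i; rewrite !mxE; congr (_%:R).
by rewrite [in RHS](divn_eq k (p ^ m)) addnC mulnC digit_low.
Qed.

Lemma dvec_bij m : bijective (fun n : 'I_(p ^ m) => dvec p m n).
Proof.
apply: inj_card_bij; last by rewrite card_mx card_Fp// muln1 card_ord.
move=> n n' nn'; apply: val_inj; apply: (digit_inj (ltn_ord n) (ltn_ord n')) => i im.
have := congr1 (fun v : 'cV['F_p]_m => nat_of_ord (v (Ordinal im) 0)) nn'.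
by rewrite !mxE /= !val_Fp_nat// !modn_small ?digit_lt.
Qed.

Variables (m s : nat) (C : 'I_s -> 'M['F_p]_m).

(** A coordinate of a net point has at most m nonzero digits, so that the digits
    of [k] from position m on do not contribute. *)
Lemma wal1_netpt k n j :
  wal1 p k (netpt R C n j) = chr R (dvec p m k) (C j *m dvec p m n).
Proof.
have [a am ka] : exists2 a, (m <= a)%N & (k < p ^ a)%N.
  exists (m + k)%N; first exact: leq_addr.
  by rewrite (leq_trans (ltn_expl k p1))// leq_exp2l// leq_addl.
rewrite (wal1E pp _ ka) /chr [LHS]omega_expE//; congr (_ ^+ nat_of_ord _).
rewrite natr_sum (bigID (fun i : 'I_a => (i < m)%N)) /= [X in _ + X]big1 ?addr0.
  rewrite -(big_ord_widen _ (fun i =>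
    (xdigit p (netpt R C n j) i * digit p k i)%:R : 'F_p) am).
  apply: eq_bigr => i _; rewrite xdigit_netpt// natrM natr_Zp mulrC.
  by rewrite [in RHS]mxE.
by move=> i; rewrite -leqNgt => mi; rewrite xdigit_netpt_ge.
Qed.

Lemma chr_cdot (k : {ffun 'I_s -> nat}) v :
  chr R (cdot C k) v = \prod_j chr R (dvec p m (k j)) (C j *m v).
Proof. by rewrite chr_suml//; apply: eq_bigr => j _; rewrite chr_trmx. Qed.

Lemma wal_netpt k n : wal p k (netpt R C n) = chr R (cdot C k) (dvec p m n).
Proof. by rewrite chr_cdot; apply: eq_bigr => j _; rewrite wal1_netpt. Qed.

(** On the net the univariate kernels depend on the difference of the indices
    only. *)
Lemma kernel1_netpt c q n n' j : 0 <= c -> 0 <= q -> p%:R * q < 1 ->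
  (kernel1 p c q (netpt R C n j) (netpt R C n' j))%:C%C =
  \sum_(k < p ^ m) (bcoef p c q m k)%:C%C *
    chr R (dvec p m k) (C j *m (dvec p m n - dvec p m n')).
Proof.
move=> c0 q0 pq; rewrite (kernel1_fourier pp c0 q0 pq (m := m)); last first.
  by move=> l ml; rewrite !xdigit_netpt_ge.
apply: eq_bigr => k _; rewrite !wal1_netpt -chrNr -?chrDr//.
by rewrite mulmxBr.
Qed.

Lemma netpt0 (n : 'I_(p ^ m)) : dvec p m n = 0 -> netpt R C n = fun=> 0.
Proof.
move=> n0; apply/funext => j; rewrite /netpt n0 mulmx0 big1// => i _.
by rewrite mxE mul0r.
Qed.

End NetCharacters.

(** * The variance as a sum over frequencies *)

Section SplineVariance.
Variables (R : realType) (p m s : nat) (C : 'I_s -> 'M['F_p]_m).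
Hypothesis pp : prime p.
Let p1 : (1 < p)%N := prime_gt1 pp.
Let p0 : (0 < p)%N := prime_gt0 pp.
Let pm0 : (0 < p ^ m)%N. Proof. by rewrite expn_gt0 p0. Qed.
Local Notation vec := 'cV['F_p]_m.
Local Notation N := (p ^ m)%N.
Local Notation dv := (dvec p m).

Definition net_trans (a : 'I_N -> R[i]) (h : vec) : R[i] :=
  \sum_n a n * chr R h (dv n).

Lemma net_trans_dvec (F : vec -> R[i]) h :
  net_trans (fun n => F (dv n)) h = trans F h.
Proof.
rewrite /trans (reindex (fun n : 'I_N => dv n))//=.
exact: onW_bij (dvec_bij pp m).
Qed.

Lemma net_trans_conv (c : 'I_N -> R[i]) (F : vec -> R[i]) h :
  net_trans (fun n => \sum_n' c n' * F (dv n - dv n')) h =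
  net_trans c h * trans F h.
Proof.
have [enc dvK encK] := dvec_bij pp m.
have e := onW_bij predT (dvec_bij pp m).
have cE : c = fun n => (c \o enc) (dv n) by apply/funext => n; rewrite /= dvK.
rewrite [in RHS]cE net_trans_dvec -trans_conv// -net_trans_dvec.
congr net_trans; apply/funext => n.
by rewrite [RHS](reindex (fun n : 'I_N => dv n))//=; apply: eq_bigr => n' _; rewrite dvK.
Qed.

Lemma net_plancherel (c : 'I_N -> R[i]) (F : vec -> R[i]) :
  N%:R * \sum_n \sum_n' c n * c n' * F (dv n - dv n') =
  \sum_h net_trans c (- h) * (net_trans c h * trans F h).
Proof.
have [enc dvK encK] := dvec_bij pp m.
have e := onW_bij predT (dvec_bij pp m).
have cE : c = fun n => (c \o enc) (dv n) by apply/funext => n; rewrite /= dvK.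
have tE h : net_trans c h = trans (c \o enc) h by rewrite [in LHS]cE net_trans_dvec.
under [RHS]eq_bigr do rewrite !tE.
rewrite -plancherel_conv//; congr (_ * _).
rewrite [RHS](reindex (fun n : 'I_N => dv n))//=; apply: eq_bigr => n _.
rewrite [RHS](reindex (fun n : 'I_N => dv n))//=; apply: eq_bigr => n' _.
by rewrite !dvK.
Qed.

Variables (alpha : R) (gamma : 'I_s -> R) (u : {set 'I_s}).
Hypotheses (alpha1 : 1 < alpha) (gamma0 : forall j, 0 < gamma j).

Let c0 := Kc_gt0 pp alpha1.
Let q0 := Kq_gt0 pp alpha.
Let pq := Kq_lt1 pp alpha1.
Let pq2 := Kq2_lt1 pp alpha1.

Definition netK (v : vec) : R[i] := \prod_j (1 + (gamma j)%:C%C *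
  \sum_(k < N) (bcoef p (Kc p alpha) (Kq p alpha) m k)%:C%C *
    chr R (dv k) (C j *m v)).

Definition netR (v : vec) : R[i] := \prod_(j in u)
  \sum_(k < N) (bcoef p (Kc p alpha ^+ 2) (Kq p alpha ^+ 2) m k)%:C%C *
    chr R (dv k) (C j *m v).

Lemma Kker_netpt n n' :
  Kker p alpha gamma (netpt R C n) (netpt R C n') = netK (dv n - dv n').
Proof.
apply: eq_bigr => j _; rewrite K1E// kernel1_netpt// ?ltW//.
Qed.

Lemma Rker_netpt n n' :
  Rker p alpha u (netpt R C n) (netpt R C n') = netR (dv n - dv n').
Proof.
by apply: eq_bigr => j _; rewrite R1E// kernel1_netpt// ?exprn_ge0// ltW.
Qed.

Let n0 : 'I_N := Ordinal pm0.

Lemma dvec0 : dv n0 = 0.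
Proof. by apply/colP => i; rewrite !mxE /digit div0n mod0n. Qed.

Lemma Kker_netpt0 n : Kker p alpha gamma (netpt R C n) (fun=> 0) = netK (dv n).
Proof. by rewrite -(netpt0 R C dvec0) Kker_netpt dvec0 subr0. Qed.

Lemma Rker_netpt0 n : Rker p alpha u (netpt R C n) (fun=> 0) = netR (dv n).
Proof. by rewrite -(netpt0 R C dvec0) Rker_netpt dvec0 subr0. Qed.

(** The Fourier coefficients of the kernel on the net are positive: the one at h
    collects a positive amount from every wavenumber in D(- h), which is not
    empty. *)
Lemma trans_netK_neq0 h : (forall h, Dset C h !=set0) -> trans netK h != 0.
Proof.
move=> D0.
pose a j (k : 'I_N) : R := (k == n0)%:R +
  gamma j * bcoef p (Kc p alpha) (Kq p alpha) m k.
have a0 j k : 0 < a j k.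
  by rewrite ltr_wpDl// mulr_gt0// bcoef_gt0.
pose cd (f : {ffun 'I_s -> 'I_N}) : vec := cdot C [ffun j => f j : nat].
have -> : netK = fun v => \sum_(f : {ffun 'I_s -> 'I_N})
    (\prod_j a j (f j))%:C%C * chr R (cd f) v.
  apply/funext => v; rewrite /netK.
  have E j : 1 + (gamma j)%:C%C * \sum_(k < N)
      (bcoef p (Kc p alpha) (Kq p alpha) m k)%:C%C * chr R (dv k) (C j *m v) =
      \sum_(k < N) (a j k)%:C%C * chr R (dv k) (C j *m v).
    under [RHS]eq_bigr do rewrite rmorphD mulrDl rmorphM -mulrA.
    rewrite big_split /= -mulr_sumr; congr (_ + _).
    rewrite (bigD1 n0)// eqxx dvec0 chr0l// rmorph1 mulr1 big1 => [|k /negbTE ->].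
      by rewrite /= addr0.
    by rewrite rmorph0 mul0r.
  under eq_bigr do rewrite E.
  rewrite bigA_distr_bigA /=; apply: eq_bigr => f _.
  rewrite big_split /= rmorph_prod; congr (_ * _).
  by rewrite chr_cdot//; apply: eq_bigr => j _; rewrite ffunE.
rewrite trans_chr// mulf_neq0// ?pnatr_eq0 -?lt0n//.
have [k Dk] := D0 (- h).
pose f0 : {ffun 'I_s -> 'I_N} := [ffun j => Ordinal (ltn_pmod (k j) pm0)].
have f0h : cd f0 == - h.
  rewrite -Dk; apply/eqP; apply: eq_bigr => j _.
  by rewrite !ffunE /= dvec_modn.
rewrite -(rmorph_sum (real_complex R)) -(rmorph0 (real_complex R)).
rewrite (inj_eq (@complexI R)) (bigD1 f0)//= gt_eqF// ltr_wpDr//.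
  by apply: sumr_ge0 => f _; apply: prodr_ge0 => j _; exact: ltW.
by apply: prodr_gt0.
Qed.

Variable c : 'I_N -> R.
Local Notation cc := (fun n => (c n)%:C%C : R[i]).

Lemma rsplineE (x : 'I_s -> R) : rspline C alpha gamma c x =
  \sum_n c n * \prod_j
    (1 + gamma j * kernel1 p (Kc p alpha) (Kq p alpha) (x j) (netpt R C n j)).
Proof.
rewrite /rspline (_ : spline _ _ _ _ _ = (\sum_n c n * \prod_j
    (1 + gamma j * kernel1 p (Kc p alpha) (Kq p alpha) (x j) (netpt R C n j)))%:C%C)//.
rewrite rmorph_sum; apply: eq_bigr => n _; rewrite rmorphM rmorph_prod.
congr (_ * _); apply: eq_bigr => j _.
by rewrite rmorphD rmorphM rmorph1 K1E.
Qed.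

(** The variance is a quadratic form in the coefficients whose matrix depends on
    the difference of the indices. *)
Lemma spline_variance : u != finset.set0 ->
  (effect_variance (rspline C alpha gamma c) u)%:C%C =
  ((\prod_(j in u) gamma j) ^+ 2)%:C%C / N%:R *
  \sum_h net_trans cc (- h) * (net_trans cc h * trans netR h).
Proof.
move=> u0; rewrite -net_plancherel -mulrA mulKf ?pnatr_eq0 -?lt0n//.
have -> : rspline C alpha gamma c = fun x => \sum_n c n * \prod_j
    (1 + gamma j * kernel1 p (Kc p alpha) (Kq p alpha) (x j) (netpt R C n j)).
  by apply/funext => x; exact: rsplineE.
have nk n j : bmeas (fun y => gamma j * kernel1 p (Kc p alpha) (Kq p alpha) y (netpt R C n j)).
  by apply: bmeasZ; exact: bmeas_kernel1.
rewrite (variance_product c nk) => [|n j|//]; last first.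
  by rewrite int01Z ?int01_kernel1 ?mulr0//; exact: bmeas_kernel1.
rewrite rmorph_sum mulr_sumr; apply: eq_bigr => n _.
rewrite rmorph_sum mulr_sumr; apply: eq_bigr => n' _.
rewrite -Rker_netpt /Rker [in LHS]rmorphM [in LHS]rmorphM mulrCA; congr (_ * _).
rewrite -prodrXl [in LHS]rmorph_prod [in RHS]rmorph_prod -big_split /=.
apply: eq_bigr => j _.
rewrite R1E// -rmorphM; congr (_%:C%C).
rewrite -(int01_kernel1M pp c0 q0 pq).
rewrite -int01Z; last by apply: bmeasM; exact: bmeas_kernel1.
by congr int01; apply/funext => y; rewrite mulrACA -expr2.
Qed.

End SplineVariance.

(** * The variance formula and its computation *)

Section CosetSums.
Variables (R : realType) (p m s : nat) (C : 'I_s -> 'M['F_p]_m).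
Hypothesis pp : prime p.
Let p1 : (1 < p)%N := prime_gt1 pp.
Let p0 : (0 < p)%N := prime_gt0 pp.
Let pm0 : (0 < p ^ m)%N. Proof. by rewrite expn_gt0 p0. Qed.
Local Notation N := (p ^ m)%N.
Local Notation dv := (dvec p m).

Lemma ctilde_net_trans (c : 'I_N -> R) k :
  ctilde C c k = N%:R^-1 * net_trans (fun n => (c n)%:C%C) (- cdot C k).
Proof.
rewrite /ctilde /net_trans natrX; congr (_ * _); apply: eq_bigr => n _.
by rewrite wal_netpt// chrNl.
Qed.

Lemma conj_net_trans (c : 'I_N -> R) h :
  Num.conj (net_trans (fun n => (c n)%:C%C) h) =
  net_trans (fun n => (c n)%:C%C) (- h).
Proof.
rewrite /net_trans rmorph_sum; apply: eq_bigr => n _.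
by rewrite rmorphM chrNl//; congr (_ * _); exact: conjc_real.
Qed.

Lemma norm_ctilde (c : 'I_N -> R) k : `|ctilde C c k| ^+ 2 =
  N%:R ^- 2 * (net_trans (fun n => (c n)%:C%C) (- cdot C k) *
               net_trans (fun n => (c n)%:C%C) (cdot C k)).
Proof.
rewrite normCK ctilde_net_trans rmorphM mulrACA [X in _ * (_ * X)](conj_net_trans c) opprK.
by rewrite fmorphV rmorph_nat -invfM -expr2.
Qed.

Lemma Rtilde_trans (alpha : R) u k : 1 < alpha ->
  Rtilde C alpha u k = N%:R^-1 * trans (netR C alpha u) (cdot C k).
Proof.
move=> alpha1; rewrite /Rtilde natrX -(net_trans_dvec pp); congr (_ * _).
by apply: eq_bigr => n _; rewrite wal_netpt// Rker_netpt0.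
Qed.

Lemma sum_Kset (G : 'cV['F_p]_m -> R[i]) : (forall h, Dset C h !=set0) ->
  \sum_(k \in Kset C) G (cdot C k) = \sum_h G h.
Proof.
move=> D0; rewrite -(reindex_fsbig (cdot C) (Kset C) setT G (Kset_bij D0)).
rewrite -[RHS]big_enum [RHS]fsbig_seq ?enum_uniq//= (_ : [set` _] = setT)//.
by apply/seteqP; split=> h //= _; rewrite mem_enum.
Qed.

Lemma mdft_net_trans (X : Type) (a : nat -> X -> R[i]) (n : 'I_N) x :
  mdft p m (omega R p) a n x = net_trans (fun k => a k x) (dv n).
Proof.
apply: eq_bigr => k _; congr (_ * _); rewrite /chr [LHS]omega_expE//.
congr (_ ^+ nat_of_ord _); rewrite natr_sum; apply: eq_bigr => i _.
by rewrite !mxE natrM mulrC.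
Qed.

(** The cosets enter the sum through [cdot] only, so that the sum over the
    chosen representatives is a sum over all frequencies. *)
Lemma variance_Kset (alpha : R) (gamma : 'I_s -> R) (u : {set 'I_s})
    (c : 'I_N -> R) :
  1 < alpha -> (forall j, 0 < gamma j) -> u != finset.set0 ->
  (forall h : 'cV['F_p]_m, Dset C h !=set0) ->
  (effect_variance (rspline C alpha gamma c) u)%:C%C =
    ((\prod_(j in u) gamma j) ^+ 2)%:C%C * p%:R ^+ (2 * m) *
    \sum_(k \in Kset C) `|ctilde C c k| ^+ 2 * Rtilde C alpha u k.
Proof.
move=> alpha1 gamma0 u0 D0.
have N0 : N%:R != 0 :> R[i] by rewrite pnatr_eq0 -lt0n.
rewrite spline_variance//.
pose G h : R[i] := N%:R ^- 3 *
  (net_trans (fun n => (c n)%:C%C) (- h) * (net_trans (fun n => (c n)%:C%C) h *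
   trans (netR C alpha u) h)).
rewrite [X in _ = _ * X](_ : _ = \sum_(k \in Kset C) G (cdot C k)); last first.
  apply: eq_fsbigr => k _; rewrite norm_ctilde// Rtilde_trans// /G.
  by rewrite mulrACA -invfM -exprSr -mulrA.
rewrite sum_Kset// /G -mulr_sumr mulnC exprM -natrX.
move: (\sum_h _) (_%:C%C) (_%:R) N0 => S g n n0.
by field.
Qed.

End CosetSums.

Section VarianceProgram.
Variables (R : realType) (p m s : nat) (C : 'I_s -> 'M['F_p]_m).
Variables (u : {set 'I_s}) (gamma_u : R).
Hypotheses (pp : prime p) (m0 : (0 < m)%N) (u0 : u != finset.set0).
Hypothesis D0 : forall h : 'cV['F_p]_m, Dset C h !=set0.
Let p1 : (1 < p)%N := prime_gt1 pp.
Let p0 : (0 < p)%N := prime_gt0 pp.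
Let pm0 : (0 < p ^ m)%N. Proof. by rewrite expn_gt0 p0. Qed.
Local Notation N := (p ^ m)%N.
Local Notation L := (trunc_log 2 p).

(** The interpolation problems that one program has to solve: tuples
    (alpha, gamma, f, c). *)
Definition problem : Type :=
  {t : R * ('I_s -> R) * (('I_s -> R) -> R) * ('I_N -> R) |
    [/\ 1 < t.1.1.1, forall j, 0 < t.1.1.2 j,
      \prod_(j in u) t.1.1.2 j = gamma_u &
      forall n, spline C t.1.1.1 t.1.1.2 t.2 (netpt R C n) =
        (t.1.2 (netpt R C n))%:C%C]}.

Definition problem_data (x : problem) : datum N -> R[i] :=
  net_data C (sval x).1.1.1 (sval x).1.1.2 u (sval x).1.2.

Definition problem_variance (x : problem) : R[i] :=
  (effect_variance
    (rspline C (sval x).1.1.1 (sval x).1.1.2 (sval x).2) u)%:C%C.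

Local Notation computes := (computes problem_data).

Definition data_seq (d : 'I_N -> datum N) (n : nat) (x : problem) : R[i] :=
  problem_data x (d (insubd (Ordinal pm0) n)).

Definition data_trans (d : 'I_N -> datum N) (h : 'I_N) : problem -> R[i] :=
  mdft p m (omega R p) (data_seq d) h.

Lemma computes_data_trans d : computes (m * (78 * L) * N) set0
  (mdft p m (omega R p) (data_seq d) @` `I_N).
Proof.
have c0 : computes (N * 0) set0 (\bigcup_(n in `I_N) [set data_seq d n]).
  by apply: computes_bigcup => n _; exact: computes_inp.
rewrite muln0 in c0; rewrite -[X in computes X]add0n.
apply: (computes_trans c0).
apply: (computes_mdft p0) => [a V Va|n nN]; last by right; exists n.
apply: computes_prime_dft => //; last exact: omega_neq0.
by move=> z; exists (sqrtC z); exact: sqrtCK.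
Qed.

Lemma data_transE d h x :
  data_trans d h x = net_trans (fun n => problem_data x (d n)) (dvec p m h).
Proof.
rewrite /data_trans mdft_net_trans//; congr net_trans; apply/funext => n.
by rewrite /data_seq valKd.
Qed.

Lemma data_trans_Kval h x : data_trans (@Kval N) h x =
  trans (netK C (sval x).1.1.1 (sval x).1.1.2) (dvec p m h).
Proof.
case: (svalP x) => al1 ga0 _ _.
rewrite data_transE -(net_trans_dvec pp); congr net_trans; apply/funext => n.
exact: Kker_netpt0.
Qed.

Lemma data_trans_Rval h x :
  data_trans (@Rval N) h x = trans (netR C (sval x).1.1.1 u) (dvec p m h).
Proof.
case: (svalP x) => al1 ga0 _ _.
rewrite data_transE -(net_trans_dvec pp); congr net_trans; apply/funext => n.
exact: Rker_netpt0.
Qed.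

(** The interpolation conditions are a convolution equation. *)
Lemma data_trans_Fval h x : data_trans (@Fval N) h x =
  net_trans (fun n => ((sval x).2 n)%:C%C) (dvec p m h) *
  data_trans (@Kval N) h x.
Proof.
case: (svalP x) => al1 ga0 _ fE.
rewrite data_trans_Kval -(net_trans_conv pp) data_transE.
congr net_trans; apply/funext => n.
rewrite /problem_data /net_data -fE; apply: eq_bigr => n' _.
by rewrite Kker_netpt.
Qed.

Lemma data_trans_Kval_neq0 h x : data_trans (@Kval N) h x != 0.
Proof.
case: (svalP x) => al1 ga0 _ _.
by rewrite data_trans_Kval; exact: trans_netK_neq0.
Qed.

(** Three transforms take 78 m N L operations each; per frequency there are a
    division, two multiplications and an addition, and there is one final
    scaling: 4 N + 1 <= 5 m N L. *)
Lemma computes_variance :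
  computes (239 * (m * N * L)) set0 [set problem_variance].
Proof.
have [enc dvK encK] := dvec_bij pp m.
pose nord (n : nat) : 'I_N := insubd (Ordinal pm0) n.
have nordK (n : 'I_N) : nord n = n by exact: valKd.
pose chat h x := data_trans (@Fval N) h x / data_trans (@Kval N) h x.
(* the coefficients of the spline are real, so that the transform at the
   opposite frequency is the complex conjugate *)
pose csq (h : 'I_N) x := chat (enc (- dvec p m h)) x * chat h x.
pose term h x := csq h x * data_trans (@Rval N) h x.
have chatE h x :
    chat h x = net_trans (fun n => ((sval x).2 n)%:C%C) (dvec p m h).
  by rewrite /chat data_trans_Fval mulfK// data_trans_Kval_neq0.
have transP d (h : 'I_N) :
    (mdft p m (omega R p) (data_seq d) @` `I_N) (data_trans d h).
  by exists h => //=; exact: ltn_ord.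
have cW := computes_setU (computes_setU (computes_data_trans (@Fval N))
  (computes_data_trans (@Kval N))) (computes_data_trans (@Rval N)).
set W := (_ `|` _ `|` _) in cW.
pose fam (v : 'I_N -> problem -> R[i]) := \bigcup_(h in `I_N) [set v (nord h)].
have famP v h : fam v (v h).
  by exists h; [exact: ltn_ord | rewrite nordK].
have computes_fam n V v :
    (forall h, computes n V [set v h]) -> computes (N * n) V (fam v).
  by move=> cv; apply: computes_bigcup => h _; exact: cv.
have c1 : computes (N * 1) (set0 `|` W) (fam chat).
  apply: computes_fam => h; apply: computes_div.
  - exact: data_trans_Kval_neq0.
  - by right; left; left; exact: transP.
  - by right; left; right; exact: transP.
have {}c1 := computes_seq cW c1.
have c2 : computes (N * 1) (set0 `|` (W `|` fam chat)) (fam csq).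
  by apply: computes_fam => h; apply: computes_mul; right; right; exact: famP.
have {}c2 := computes_seq c1 c2.
have c3 : computes (N * 1) (set0 `|` (W `|` fam chat `|` fam csq)) (fam term).
  apply: computes_fam => h; apply: computes_mul; right; first by right; exact: famP.
  by left; left; right; exact: transP.
have {}c3 := computes_trans c2 c3.
have c4 := @computes_sum _ _ _ problem_data N (fun h => term (nord h))
  (set0 `|` fam term) (fun h hN => or_intror (ex_intro2 _ _ h hN erefl)).
have {}c4 := computes_trans c3 c4.
have c5 := @computes_scale _ _ _ problem_data ((gamma_u ^+ 2)%:C%C / N%:R) _
  (set0 `|` [set fun x => \sum_(h < N) term (nord h) x]) (or_intror erefl).
have {}c5 := computes_trans c4 c5.
apply: computesS c5 => //; last first.
  move=> _ ->; apply/funext => x; case: (svalP x) => al1 ga0 gu fE.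
  rewrite /problem_variance spline_variance// gu mulrC; congr (_ * _).
  rewrite (reindex (fun n : 'I_N => dvec p m n))/=; last first.
    exact: onW_bij (dvec_bij pp m).
  apply: eq_bigr => h _.
  by rewrite nordK /term /csq !chatE encK data_trans_Rval mulrA.
have L0 : (0 < L)%N by rewrite trunc_log_gt0.
have : (N <= m * N * L)%N by rewrite mulnAC leq_pmull// muln_gt0 m0.
by lia.
Qed.

End VarianceProgram.

Theorem mainTheorem5 (R : realType) :
  (forall (p m s : nat) (C : 'I_s -> 'M['F_p]_m) (u : {set 'I_s})
      (alpha : R) (gamma : 'I_s -> R) (f : ('I_s -> R) -> R)
      (c : 'I_(p ^ m) -> R),
    prime p -> (0 < m)%N -> u != finset.set0 ->
    (forall h : 'cV['F_p]_m, Dset C h !=set0) ->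
    1 < alpha -> (forall j, 0 < gamma j) ->
    (forall n : 'I_(p ^ m),
       spline C alpha gamma c (netpt R C n) = (f (netpt R C n))%:C%C) ->
    (effect_variance (rspline C alpha gamma c) u)%:C%C =
      ((\prod_(j in u) gamma j) ^+ 2)%:C%C * p%:R ^+ (2 * m) *
      \sum_(k \in Kset C) `|ctilde C c k| ^+ 2 * Rtilde C alpha u k)
  /\
  (exists B : R,
    forall (p m s : nat) (C : 'I_s -> 'M['F_p]_m) (u : {set 'I_s})
      (gamma_u : R),
    prime p -> (0 < m)%N -> u != finset.set0 ->
    (forall h : 'cV['F_p]_m, Dset C h !=set0) ->
    exists P : program R[i] (datum (p ^ m)),
      (size (instrs P))%:R <= B * (m%:R * p%:R ^+ m * ln p%:R) /\
      forall (alpha : R) (gamma : 'I_s -> R) (f : ('I_s -> R) -> R)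
        (c : 'I_(p ^ m) -> R),
      1 < alpha -> (forall j, 0 < gamma j) ->
      \prod_(j in u) gamma j = gamma_u ->
      (forall n : 'I_(p ^ m),
         spline C alpha gamma c (netpt R C n) = (f (netpt R C n))%:C%C) ->
      run (net_data C alpha gamma u f) P =
        Some ((effect_variance (rspline C alpha gamma c) u)%:C%C)).
Proof.
split=> [p m s C u alpha gamma f c pp _ u0 D0 alpha1 gamma0 _|].
  exact: variance_Kset.
(* trunc_log 2 p <= ln p / ln 2 *)
exists (239 / ln 2) => p m s C u gamma_u pp m0 u0 D0.
have [cs sz [mem memE memV]] := computesP
  (computes_variance gamma_u pp m0 u0 D0) (avail_nil _).
have [op opE] := memV _ (or_intror erefl).
exists (Program cs op); split=> [|alpha gamma f c alpha1 gamma0 gu fE].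
  set L := trunc_log 2 p in sz.
  have pL : L%:R * ln 2 <= ln p%:R :> R.
    rewrite mulr_natl -lnXn// ler_ln ?posrE ?exprn_gt0 ?ltr0n ?prime_gt0//.
    by rewrite -natrX ler_nat trunc_logP// ?prime_gt0.
  have l2 : 0 < ln 2 :> R by rewrite ln_gt0// ltr1n.
  apply: (@le_trans _ _ (239 * (m%:R * (p ^ m)%:R * L%:R))).
    by rewrite -!natrM ler_nat.
  rewrite -natrX -[leRHS]mulrA ler_wpM2l//.
  rewrite mulrCA ler_wpM2l// ?mulr_ge0//.
  by rewrite mulrC ler_pdivlMr.
pose x : problem C u gamma_u :=
  exist _ (alpha, gamma, f, c) (And4 alpha1 gamma0 gu fE).
exact: (etrans (run_exec op (memE x)) (opE x)).
Qed.
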